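(* Let $A,B,C$ be pairwise disjoint finite subsets of $\mathbb Z$ and let $\varphi$ be an even faithful state on $\mathcal A_{ABC}=\mathcal A(A\cup B\cup C)$ with density $\rho$. Then $\varphi$ is a Markov triplet if and only if there are positive elements $x\in\mathcal A_{AB}$ and $y\in\mathcal A_{BC}$ such that $$\rho=xy.$$ Moreover, in this case $x$ and $y$ can be chosen even.
   Context: CAR algebra: the $C^*$-algebra generated by $\{a_i: i\in\mathbb Z\}$ with $a_ia_j+a_ja_i=0$ and $a_ia_j^*+a_j^*a_i=\delta_{ij}1$ for all $i,j$. For $I\subset\mathbb Z$, $\mathcal A(I)$ is the unital $C^*$-subalgebra generated by $\{a_i: i\in I\}$; for finite $I$ it is isomorphic to the full matrix algebra $M_{2^{|I|}}(\mathbb C)$. $\tau$ is the unique tracial state. For disjoint finite $A,B,C$ write $\mathcal A_A=\mathcal A(A)$, $\mathcal A_{AB}=\mathcal A(A\cup B)$, $\mathcal A_{BC}=\mathcal A(B\cup C)$, $\mathcal A_B=\mathcal A(B)$. The density of $\varphi$ is the element $\rho\in\mathcal A_{ABC}$ with $\varphi(x)=\tau(\rho x)$ for all $x\in\mathcal A_{ABC}$. $\Theta$ is the automorphism of the CAR algebra with $\Theta(a_i)=-a_i$ for all $i$. An element $a$ is even if $\Theta(a)=a$; a state $\varphi$ on $\mathcal A_{ABC}$ is even if $\varphi\circ\Theta=\varphi$ (equivalently, $\rho$ is even). Markov triplet: $\varphi$ is a Markov triplet if there is a completely positive, identity preserving map $E:\mathcal A_{ABC}\to\mathcal A_{AB}$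 such that (i) $E(xy)=xE(y)$ for all $x\in\mathcal A_A$, $y\in\mathcal A_{ABC}$; (ii) $\varphi\circ E=\varphi$; (iii) $E(\mathcal A_{BC})\subseteq\mathcal A_B$. *)

(* Defs.v *)
From HB Require Import structures.
From mathcomp Require Import all_boot all_order all_algebra complex.
From mathcomp Require Import boolp classical_sets cardinality reals topology normedtype.

Set Implicit Arguments.
Unset Strict Implicit.
Unset Printing Implicit Defensive.

Import Order.TTheory GRing.Theory Num.Theory.
Import numFieldNormedType.Exports.

Local Open Scope classical_set_scope.
Local Open Scope ring_scope.
Local Open Scope complex_scope.

(* The norm is a field of the structure rather than an inherited norm: a
   noncommutative ring cannot be joined with the normed modules of the library,
   whose only normed rings are the (commutative) numDomainTypes. *)
HB.mixin Record isCStarAlgebra (R : realType) A of GRing.Algebra R[i] A := {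
  star : A -> A;
  starK : involutive star;
  starD : {morph star : x y / x + y};
  starZ : forall (k : R[i]) (x : A), star (k *: x) = k^* *: star x;
  starM : forall x y : A, star (x * y) = star y * star x;
  cstar_norm : A -> R;
  cstar_norm0_eq0 : forall x : A, cstar_norm x = 0 -> x = 0;
  cstar_normZ : forall (k : R[i]) (x : A),
    (cstar_norm (k *: x))%:C = `|k| * (cstar_norm x)%:C;
  ler_cstar_normD : forall x y : A,
    cstar_norm (x + y) <= cstar_norm x + cstar_norm y;
  ler_cstar_normM : forall x y : A,
    cstar_norm (x * y) <= cstar_norm x * cstar_norm y;
  cstar_norm_star : forall x : A, cstar_norm (star x * x) = cstar_norm x ^+ 2;
  cstar_complete : forall u : nat -> A,
    (forall e : R, 0 < e -> exists N : nat, forall m n : nat,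
       (N <= m)%N -> (N <= n)%N -> cstar_norm (u m - u n) < e) ->
    exists l : A, cstar_norm (u n - l) @[n --> \oo] --> (0 : R)
}.

#[short(type="cstarAlgType")]
HB.structure Definition CStarAlgebra (R : realType) :=
  {A of GRing.Algebra R[i] A & isCStarAlgebra R A}.

Section CStar.
Context {R : realType} {U : cstarAlgType R}.
Implicit Types (S T : set U) (rho : U) (phi : U -> R[i]).

Definition norm_closed S : Prop :=
  forall (u : nat -> U) (l : U),
    (forall n, S (u n)) -> cstar_norm (u n - l) @[n --> \oo] --> (0 : R) -> S l.

Definition cstar_subalgebra S : Prop :=
  [/\ S 1,
      forall (k : R[i]) x y, S x -> S y -> S (k *: x + y),
      forall x y, S x -> S y -> S (x * y),
      forall x, S x -> S (star x)
    & norm_closed S].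

Definition cstar_generated (G : set U) : set U := smallest cstar_subalgebra G.

(* Maps defined on a C*-subalgebra S are represented by functions on U of which
   only the restriction to S matters. *)
Definition linear_on (V : lmodType R[i]) S (f : U -> V) : Prop :=
  forall (k : R[i]) x y, S x -> S y -> f (k *: x + y) = k *: f x + f y.

(* Positivity in the C*-algebra S. *)
Definition positive_in S (x : U) : Prop := exists2 z, S z & x = star z * z.

(* Positivity in the C*-algebra 'M_n(S). *)
Definition positive_mx_in S (n : nat) (X : 'M[U]_n) : Prop :=
  exists2 Z : 'M[U]_n, forall i j, S (Z i j) & X = map_mx star Z^T *m Z.

Definition completely_positive S T (E : U -> U) : Prop :=
  [/\ forall x, S x -> T (E x),
      linear_on S E
    & forall (n : nat) (X : 'M[U]_n),
        positive_mx_in S X -> positive_mx_in T (map_mx E X)].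

(* In R[i], [0 <= z] means that z is real and nonnegative. *)
Definition state_on S phi : Prop :=
  [/\ linear_on S (phi : U -> R[i]^o),
      forall x, positive_in S x -> 0 <= phi x
    & phi 1 = 1].

Definition faithful_on S phi : Prop :=
  forall x, S x -> phi (star x * x) = 0 -> x = 0.

Definition tracial_state (tau : U -> R[i]) : Prop :=
  state_on setT tau /\ forall x y, tau (x * y) = tau (y * x).

Definition density_on (tau : U -> R[i]) S phi rho : Prop :=
  S rho /\ forall x, S x -> phi x = tau (rho * x).

(* U is the CAR algebra with generators a i, i in Z. *)
Definition CAR_algebra (a : int -> U) : Prop :=
  [/\ forall i j, a i * a j + a j * a i = 0,
      forall i j, a i * star (a j) + star (a j) * a i = (i == j)%:R
    & cstar_generated (range a) = setT].

Definition local_algebra (a : int -> U) (I : set int) : set U :=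
  cstar_generated (a @` I).

Definition parity_automorphism (a : int -> U) (Theta : U -> U) : Prop :=
  [/\ bijective Theta,
      forall x, Theta (star x) = star (Theta x)
    & forall i, Theta (a i) = - a i].

Definition even_element (Theta : U -> U) (x : U) : Prop := Theta x = x.

Definition even_on (Theta : U -> U) S phi : Prop :=
  forall x, S x -> phi (Theta x) = phi x.

Definition markov_triplet (a : int -> U) (A B C : set int) phi : Prop :=
  exists E : U -> U,
    let ABC := local_algebra a (A `|` B `|` C) in
    [/\ completely_positive ABC (local_algebra a (A `|` B)) E /\ E 1 = 1,
        forall x y, local_algebra a A x -> ABC y -> E (x * y) = x * E y,
        forall x, ABC x -> phi (E x) = phi x
      & forall x, local_algebra a (B `|` C) x -> local_algebra a B (E x)].

End CStar.

(* Main.v *)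
Require Import Defs.
From HB Require Import structures.
From mathcomp Require Import all_boot all_order all_algebra complex.
From mathcomp Require Import boolp classical_sets cardinality reals topology normedtype.
From mathcomp Require Import ring lra.

Set Implicit Arguments.
Unset Strict Implicit.
Unset Printing Implicit Defensive.

Import Order.TTheory GRing.Theory Num.Theory.
Import numFieldNormedType.Exports.

Local Open Scope classical_set_scope.
Local Open Scope ring_scope.
Local Open Scope complex_scope.

(* The finite local algebras are Clifford algebras: with the self-adjoint Majorana
   generators g_k and one extra generator g_e outside the region, conjugation by
   g_e g_k flips the sign of g_k and fixes the other generators. Averaging such flips
   gives the trace-preserving conditional expectations, and by induction on the number
   of generators the faithfulness of tau and the norm-closedness of the algebras.

   If rho = x y, then x and y may be replaced by the geometric means of x, Theta x and
   of y, Theta y, which are even and have the same product. With w = y^(1/2), F the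
   expectation onto A_AB and v = F(y)^(-1/2), the map E z = v F(w z w) v is the required
   one: w and v commute with A_A because y is even.

   Conversely, if E exists, then A_A consists of fixed points of E. As E preserves the
   star and is a contraction for the inner product phi(x^* y), it has the same fixed points
   as its adjoint, whence its fixed points are stable under z |-> rho^-1 z rho and its
   inverse. Hence A_A lies in the largest subalgebra N of A_AB stable under both maps.
   If D is the density of phi on N, then D^-1 rho commutes with N; being even
   and in the commutant of A_A, it lies in A_BC, and rho = D (D^-1 rho). *)

(** * Functional calculus in finite-dimensional star-algebras *)

Section Spectral.
Context {R : realType} {W : nzRingType}.
Variables (iota : {rmorphism R[i] -> W}) (st : W -> W) (tau : W -> R[i]).

(** Scalars enter through a central morphism [iota], so that one calculus serves both [U] and the
    matrices over [U]. *)
Definition star_algebra : Prop :=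
  [/\ forall k x, GRing.comm x (iota k),
      involutive st, {morph st : x y / x + y},
      forall x y, st (x * y) = st y * st x
    & forall k, st (iota k) = iota k^*].

Definition star_subalgebra (S : set W) : Prop :=
  [/\ forall k, S (iota k), forall x y, S x -> S y -> S (x + y),
      forall x y, S x -> S y -> S (x * y) & forall x, S x -> S (st x)].

(** The spanning list [e] may leave [S], so the property passes to every subset of [S]. *)
Definition finite_dim (S : set W) : Prop :=
  exists e : seq W, forall x, S x ->
    exists c : nat -> R[i], x = \sum_(i < size e) iota (c i) * e`_i.

Definition linear_form : Prop :=
  {morph tau : x y / x + y} /\ forall k x, tau (iota k * x) = k * tau x.

Definition faithful_positive (S : set W) : Prop :=
  (forall x, S x -> 0 <= tau (st x * x)) /\
  (forall x, S x -> tau (st x * x) = 0 -> x = 0).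

(** Positivity of left multiplication by [h] on the Hilbert space of [tau]: a condition on quadratic
    forms, which can be checked before any square root is known. *)
Definition pos_elt (S : set W) (h : W) : Prop :=
  [/\ S h, st h = h & forall s, S s -> 0 <= tau (st s * h * s)].

Hypothesis algW : star_algebra.
Hypothesis linT : linear_form.

Lemma iota_comm k x : iota k * x = x * iota k.
Proof. by case: algW => H _ _ _ _; rewrite H. Qed.

Lemma stK : involutive st. Proof. by case: algW. Qed.
Lemma stD : {morph st : x y / x + y}. Proof. by case: algW. Qed.
Lemma stM x y : st (x * y) = st y * st x. Proof. by case: algW. Qed.
Lemma st_iota k : st (iota k) = iota k^*. Proof. by case: algW. Qed.
Lemma st0 : st 0 = 0.
Proof. by rewrite -(rmorph0 iota) st_iota conjc0 rmorph0. Qed.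
Lemma stN x : st (- x) = - st x.
Proof. by apply/eqP; rewrite -subr_eq0 opprK -stD addNr st0. Qed.

Lemma tauD : {morph tau : x y / x + y}. Proof. by case: linT. Qed.
Lemma tau_iota k x : tau (iota k * x) = k * tau x. Proof. by case: linT. Qed.
Lemma tau0 : tau 0 = 0.
Proof. by rewrite -(mul0r 0) -(rmorph0 iota) tau_iota mul0r. Qed.
Lemma tauN x : tau (- x) = - tau x.
Proof. by apply/eqP; rewrite -addr_eq0 -tauD addNr tau0. Qed.
Lemma tauB x y : tau (x - y) = tau x - tau y.
Proof. by rewrite tauD tauN. Qed.
Lemma tau_sum (I : Type) (r : seq I) (P : pred I) (F : I -> W) :
  tau (\sum_(i <- r | P i) F i) = \sum_(i <- r | P i) tau (F i).
Proof. exact: (big_morph _ tauD tau0). Qed.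

(** The [n] rows of coefficients have fewer than [n] columns, so their matrix has a nonzero left
    kernel vector. *)
Lemma linear_dependence (S : set W) (e : seq W) n (x : 'I_n -> W) :
    (forall y, S y ->
       exists c : nat -> R[i], y = \sum_(i < size e) iota (c i) * e`_i) ->
    (size e < n)%N -> (forall i, S (x i)) ->
  exists2 v : 'rV[R[i]]_n, v != 0 & \sum_i iota (v 0 i) * x i = 0.
Proof.
move=> He ltn Sx.
pose c i := projT1 (cid (He _ (Sx i))).
have cE i : x i = \sum_(j < size e) iota (c i j) * e`_j.
  exact: projT2 (cid (He _ (Sx i))).
pose M := \matrix_(i < n, j < size e) c i j.
have : kermx M != 0.
  rewrite -mxrank_eq0 mxrank_ker subn_eq0 -ltnNge.
  exact: leq_ltn_trans (rank_leq_col _) ltn.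
case/rowV0Pn => v /sub_kermxP vM v0; exists v => //.
under eq_bigr => i _ do rewrite cE mulr_sumr.
rewrite exchange_big big1 //= => j _.
under eq_bigr => i _ do rewrite mulrA -rmorphM.
rewrite -mulr_suml -rmorph_sum /=.
have -> : \sum_i v 0 i * c i j = (v *m M) 0 j.
  by rewrite mxE; apply: eq_bigr => i _; rewrite mxE.
by rewrite vM mxE rmorph0 mul0r.
Qed.

Definition ev (h : W) : {poly R[i]} -> W :=
  horner_morph (fun k => esym (iota_comm k h) : GRing.comm h (iota k)).
HB.instance Definition _ h := GRing.RMorphism.copy (ev h) (ev h).

Lemma evX h : ev h 'X = h. Proof. exact: horner_morphX. Qed.
Lemma evC h k : ev h k%:P = iota k. Proof. exact: horner_morphC. Qed.

(** Real coefficients keep the values at self-adjoint elements self-adjoint. *)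
Definition evr (h : W) (p : {poly R}) : W := ev h (map_poly (real_complex R) p).
HB.instance Definition _ h :=
  GRing.RMorphism.copy (evr h) (ev h \o map_poly (real_complex R)).

Lemma evrX h : evr h 'X = h. Proof. by rewrite /evr map_polyX evX. Qed.
Lemma evrC h k : evr h k%:P = iota k%:C.
Proof. by rewrite /evr map_polyC evC. Qed.

Lemma ev_comm h u p : GRing.comm u h -> GRing.comm u (ev h p).
Proof.
move=> uh; elim/poly_ind: p => [|p c IH]; first by rewrite rmorph0; apply: commr0.
rewrite rmorphD rmorphM /= evX evC; apply: commrD; first exact: commrM.
by rewrite /GRing.comm iota_comm.
Qed.

Lemma evr_comm h u p : GRing.comm u h -> GRing.comm u (evr h p).
Proof. exact: ev_comm. Qed.

Lemma st_evr h p : st h = h -> st (evr h p) = evr h p.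
Proof.
move=> hh; elim/poly_ind: p => [|p c IH]; first by rewrite rmorph0 st0.
rewrite rmorphD rmorphM /= evrX evrC stD stM hh IH st_iota conjc_real.
by congr (_ + _); apply: evr_comm.
Qed.

(** This carries square roots over to elements that are only similar to positive ones. *)
Lemma evr_intertwine h k z p : z * h = k * z -> z * evr h p = evr k p * z.
Proof.
move=> hk; elim/poly_ind: p => [|p c IH]; first by rewrite !rmorph0 mulr0 mul0r.
rewrite !rmorphD !rmorphM /= !evrX !evrC mulrDr mulrDl iota_comm.
by rewrite mulrA IH -mulrA hk mulrA.
Qed.

Lemma evr_prod h (L : seq R) :
  evr h (\prod_(x <- L) ('X - x%:P)) = \prod_(x <- L) (h - iota x%:C).
Proof.
by rewrite rmorph_prod; apply: eq_bigr => x _; rewrite rmorphB /= evrX evrC.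
Qed.

Lemma ev_prod h (Z : seq R[i]) :
  ev h (\prod_(z <- Z) ('X - z%:P)) = \prod_(z <- Z) (h - iota z).
Proof.
by rewrite rmorph_prod; apply: eq_bigr => x _; rewrite rmorphB /= evX evC.
Qed.

(** * Spectra, square roots and inverses in a star-subalgebra *)

Section Subalgebra.
Variable S : set W.
Hypothesis subS : star_subalgebra S.

Lemma sub_iota k : S (iota k). Proof. by case: subS. Qed.
Lemma sub_zero : S 0. Proof. by rewrite -(rmorph0 iota); apply: sub_iota. Qed.
Lemma sub_one : S 1. Proof. by rewrite -(rmorph1 iota); apply: sub_iota. Qed.
Lemma subD x y : S x -> S y -> S (x + y).
Proof. by case: subS => _ + _ _; apply. Qed.
Lemma subM x y : S x -> S y -> S (x * y).
Proof. by case: subS => _ _ + _; apply. Qed.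
Lemma sub_st x : S x -> S (st x).
Proof. by case: subS => _ _ _; apply. Qed.
Lemma subN x : S x -> S (- x).
Proof.
move=> Sx; rewrite -mulN1r -(rmorph1 iota) -rmorphN.
exact/subM/Sx/sub_iota.
Qed.
Lemma subB x y : S x -> S y -> S (x - y).
Proof. by move=> Sx Sy; apply/subD/subN. Qed.
Lemma subX x n : S x -> S (x ^+ n).
Proof.
by move=> Sx; elim: n => [|n IH]; rewrite ?expr0 ?exprS; [apply: sub_one | apply: subM].
Qed.
Lemma sub_sum (I : Type) (r : seq I) (F : I -> W) :
  (forall i, S (F i)) -> S (\sum_(i <- r) F i).
Proof.
by move=> SF; apply: big_ind => //; [apply: sub_zero | apply: subD].
Qed.
Lemma sub_ev h p : S h -> S (ev h p).
Proof.
move=> Sh; elim/poly_ind: p => [|p c IH]; first by rewrite rmorph0; apply: sub_zero.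
by rewrite rmorphD rmorphM /= evX evC; apply/subD/sub_iota/subM.
Qed.
Lemma sub_evr h p : S h -> S (evr h p).
Proof. exact: sub_ev. Qed.

Lemma pos_star z : faithful_positive S -> S z -> pos_elt S (st z * z).
Proof.
move=> [pS _] Sz; split; first exact/subM/Sz/sub_st.
  by rewrite stM stK.
move=> s Ss; rewrite !mulrA -stM -mulrA; apply: pS; exact: subM.
Qed.

Lemma rem_notin_uniq (T : eqType) (s : seq T) :
  (forall z, z \in s -> z \notin rem z s) -> uniq s.
Proof.
elim: s => //= a t IH H; have := H a (mem_head _ _); rewrite eqxx => aNt.
rewrite aNt; apply: IH => z zt.
have := H z; rewrite inE zt orbT => /(_ isT).
case: eqP => [az|_]; first by rewrite az zt in aNt.
by rewrite inE negb_or => /andP[].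
Qed.

Lemma map_real_ge0 (Z : seq R[i]) :
  (forall z, z \in Z -> 0 <= z) ->
  Z = map (real_complex R) (map (@complex.Re R) Z).
Proof.
elim: Z => //= z Z IH H; rewrite -IH => [|y yZ]; last first.
  by apply: H; rewrite inE yZ orbT.
congr (_ :: _); move: (H z (mem_head _ _)).
by case: z H => a b _; rewrite lecE /= => /andP[/eqP -> _].
Qed.

(** [L] may be larger than the spectrum, which lets several elements share one list. *)
Definition spectrum_in (h : W) (L : seq R) : Prop :=
  [/\ uniq L, {in L, forall x, 0 <= x} & evr h (\prod_(x <- L) ('X - x%:P)) = 0].

Hypothesis fdS : finite_dim S.
Hypothesis faithS : faithful_positive S.

Lemma faith_pos x : S x -> 0 <= tau (st x * x).
Proof. by case: faithS => + _; apply. Qed.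
Lemma faith_eq0 x : S x -> tau (st x * x) = 0 -> x = 0.
Proof. by case: faithS => _ +; apply. Qed.

(** The powers of [h] up to [size e] are linearly dependent, and the polynomial of this relation
    splits over the algebraically closed field [R[i]]. *)
Lemma annihilating_roots h : S h ->
  exists Z : seq R[i], ev h (\prod_(z <- Z) ('X - z%:P)) = 0.
Proof.
move=> Sh; case: fdS => e He.
have [v v0 Hv] := linear_dependence (x := fun i : 'I_(size e).+1 => h ^+ i)
  He (ltnSn _) (fun i => subX i Sh).
pose p := rVpoly v.
have p0 : p != 0.
  by apply: contraNneq v0 => pe; rewrite -[v]rVpolyK -/p pe linear0.
have [Z pE] := closed_field_poly_normal p; exists Z.
have hp : ev h p = 0.
  rewrite -Hv /p /rVpoly poly_def rmorph_sum; apply: eq_bigr => i _ /=.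
  by rewrite -mul_polyC rmorphM /= evC rmorphXn /= evX valK.
have l0 : lead_coef p != 0 by rewrite lead_coef_eq0.
rewrite -[LHS]mul1r -(rmorph1 iota) -(mulVf l0) rmorphM -mulrA -(evC h (lead_coef p)).
by rewrite -rmorphM /= mul_polyC -pE hp mulr0.
Qed.

(** A shortest annihilating product of linear factors plays the role of the minimal polynomial;
    positivity makes its roots nonnegative and faithfulness makes them simple. *)
Lemma spectrum_exists h : pos_elt S h -> exists L, spectrum_in h L.
Proof.
move=> [Sh hh hpos].
pose P n := `[< exists2 Z : seq R[i], size Z = n & \prod_(z <- Z) (h - iota z) = 0 >].
have exP : exists n, P n.
  have [Z HZ] := annihilating_roots Sh.
  by exists (size Z); apply/asboolP; exists Z; rewrite // -ev_prod.
have [n /asboolP[Z sZ HZ] minZ] := ex_minnP exP.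
have Hrem z : z \in Z -> \prod_(y <- rem z Z) (h - iota y) <> 0.
  move=> zZ H0; have : P (size (rem z Z)) by apply/asboolP; exists (rem z Z).
  move/minZ; rewrite size_rem // sZ; case: n sZ {minZ HZ} => [/size0nil Z0|n _].
    by rewrite Z0 in zZ.
  by rewrite /= ltnn.
have Hprod z : z \in Z ->
    (h - iota z) * \prod_(y <- rem z Z) (h - iota y) = 0.
  move=> zZ; rewrite -ev_prod -HZ -ev_prod.
  rewrite -[X in X - _](evX h) -(evC h z) -rmorphB -rmorphM /=; congr (ev h _).
  by rewrite (perm_big _ (perm_to_rem zZ)) big_cons.
(* By minimality the cofactor [w] is nonzero, and [h w = z w]; hence
   [z tau (st w * w) = tau (st w * h * w)] is nonnegative. *)
have Z0 z : z \in Z -> 0 <= z.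
  move=> zZ; set w := \prod_(y <- rem z Z) (h - iota y).
  have Sw : S w by rewrite /w -ev_prod; apply: sub_ev.
  have hw : h * w = iota z * w.
    by apply/eqP; rewrite -subr_eq0 -mulrBl Hprod.
  have := hpos w Sw; rewrite -mulrA hw mulrA -iota_comm -mulrA tau_iota.
  rewrite pmulr_lge0 // lt_def faith_pos // andbT.
  by apply/eqP => /(faith_eq0 Sw); apply: Hrem.
have ZE := map_real_ge0 Z0; set L := map _ Z in ZE.
have evL (s : seq R) :
    \prod_(z <- map (real_complex R) s) (h - iota z) =
    evr h (\prod_(x <- s) ('X - x%:P)).
  by rewrite evr_prod big_map.
exists L; split.
- rewrite -(map_inj_uniq (fmorph_inj (real_complex R))) -ZE.
  (* If [z] occurred twice, the self-adjoint [w] would have [h - iota z] as a right factor; as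
     [h - iota z] kills [w], this gives [st w * w = 0]. *)
  apply: rem_notin_uniq => z zZ; apply/negP => zrZ.
  have rE z' : rem z' Z = map (real_complex R) (map (@complex.Re R) (rem z' Z)).
    by apply: map_real_ge0 => y /mem_rem; apply: Z0.
  apply: (Hrem z zZ); set w := \prod_(y <- _) _.
  have sw : st w = w by rewrite /w rE evL st_evr.
  have Sw : S w by rewrite /w -ev_prod; apply: sub_ev.
  have wE : w = ev h (\prod_(y <- rem z (rem z Z)) ('X - y%:P)) * (h - iota z).
    rewrite {1}/w -ev_prod (perm_big _ (perm_to_rem zrZ)) big_cons /= mulrC rmorphM.
    by rewrite /= rmorphB /= evX evC.
  apply: (faith_eq0 Sw); rewrite sw {1}wE -mulrA Hprod //.
  by rewrite mulr0 tau0.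
- by move=> x /mapP[z zZ ->]; have := Z0 z zZ; case: (z) => a b; rewrite lecE => /andP[].
- by rewrite -evL -ZE.
Qed.

(** The members of [L] being distinct, a polynomial vanishing on them is divisible by the
    annihilating one. *)
Lemma evr_spectrum_eq h L p q : spectrum_in h L ->
  {in L, forall x, p.[x] = q.[x]} -> evr h p = evr h q.
Proof.
move=> [uL _ hL] pq; apply/eqP; rewrite -subr_eq0 -rmorphB /=.
have : \prod_(x <- L) ('X - x%:P) %| p - q.
  apply: uniq_roots_dvdp; last by rewrite uniq_rootsE.
  by apply/allP => x /pq; rewrite /root !hornerE => ->; rewrite subrr.
by case/dvdpP => r ->; rewrite rmorphM /= hL mulr0.
Qed.

Lemma spectrum_in_sub h (L M : seq R) : uniq M -> {in M, forall x, 0 <= x} ->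
  {subset L <= M} -> spectrum_in h L -> spectrum_in h M.
Proof.
move=> uM pM LM [uL _ hL]; split=> //.
have : \prod_(x <- L) ('X - x%:P) %| \prod_(x <- M) ('X - x%:P).
  apply: uniq_roots_dvdp; last by rewrite uniq_rootsE.
  by apply/allP => x /LM; rewrite root_prod_XsubC.
by case/dvdpP => r ->; rewrite rmorphM /= hL mulr0.
Qed.

Lemma interpolation (L : seq R) (f : R -> R) : uniq L ->
  exists p : {poly R}, {in L, forall x, p.[x] = f x}.
Proof.
elim: L => [|a L IH] /=; first by exists 0.
case/andP => aL /IH[p Hp].
pose w := \prod_(x <- L) ('X - x%:P).
have wa : w.[a] != 0 by rewrite -/(root w a) root_prod_XsubC.
exists (p + ((f a - p.[a]) / w.[a])%:P * w) => x; rewrite inE !hornerE.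
case/predU1P => [->|xL]; first by rewrite divfK // addrC subrK.
have /rootP -> : root w x by rewrite root_prod_XsubC.
by rewrite mulr0 addr0 Hp.
Qed.

(** If [r] interpolates the square root of [p] on [L], then [p] and [r ^+ 2] have the same value at
    [h]. *)
Lemma pos_evr h L p : pos_elt S h -> spectrum_in h L ->
  {in L, forall x, 0 <= p.[x]} -> pos_elt S (evr h p).
Proof.
move=> [Sh hh _] sL pL; have [uL _ _] := sL.
have [r Hr] := interpolation (fun x => Num.sqrt p.[x]) uL.
have -> : evr h p = st (evr h r) * evr h r.
  rewrite st_evr // -rmorphM /=; apply: (evr_spectrum_eq sL) => x xL.
  by rewrite hornerM Hr // -expr2 sqr_sqrtr // pL.
by apply: pos_star => //; apply: sub_evr.
Qed.

Lemma common_spectrum (hs : seq W) : {in hs, forall h, pos_elt S h} ->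
  exists L, [/\ uniq L, {in L, forall x, 0 <= x}
              & {in hs, forall h, spectrum_in h L}].
Proof.
elim: hs => [|h hs IH] H; first by exists [::].
have [|L [uL pL HL]] := IH.
  by move=> y yh; apply: H; rewrite inE yh orbT.
have [M [uM pM hM]] := spectrum_exists (H h (mem_head _ _)).
have pLM : {in undup (L ++ M), forall x, 0 <= x}.
  by move=> x; rewrite mem_undup mem_cat => /orP[/pL|/pM].
exists (undup (L ++ M)); split; rewrite ?undup_uniq // => y.
rewrite inE => /predU1P[->|/HL].
  apply: (@spectrum_in_sub _ M) => //; rewrite ?undup_uniq // => x xM.
  by rewrite mem_undup mem_cat xM orbT.
apply: spectrum_in_sub => //; rewrite ?undup_uniq // => x xM.
by rewrite mem_undup mem_cat xM.
Qed.

(** One polynomial serves all the elements because they share a list of spectral values. *)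
Lemma common_sqrt (hs : seq W) : {in hs, forall h, pos_elt S h} ->
  exists p, {in hs, forall h, pos_elt S (evr h p) /\ evr h p * evr h p = h}.
Proof.
move=> H; have [L [uL pL HL]] := common_spectrum H.
have [p Hp] := interpolation (@Num.sqrt R) uL.
exists p => h hhs; split.
  by apply: pos_evr (H h hhs) (HL h hhs) _ => x /Hp ->; apply: sqrtr_ge0.
rewrite -rmorphM /= -[RHS]evrX; apply: evr_spectrum_eq (HL h hhs) _ => x xL.
by rewrite hornerM hornerX Hp // -expr2 sqr_sqrtr // pL.
Qed.

Lemma pos_sqrt h : pos_elt S h ->
  exists p, pos_elt S (evr h p) /\ evr h p * evr h p = h.
Proof.
move=> ph; have [|p Hp] := @common_sqrt [:: h].
  by move=> y; rewrite inE => /eqP ->.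
by exists p; apply: Hp; rewrite inE.
Qed.

Lemma evr_sqr u p : evr (u * u) p = evr u (p \Po 'X^2).
Proof.
elim/poly_ind: p => [|p c IH]; first by rewrite comp_poly0 !rmorph0.
rewrite comp_poly_MXaddC rmorphD /= rmorphM /= evrX evrC IH.
rewrite [in RHS]rmorphD /= evrC; congr (_ + _).
by rewrite [in RHS]rmorphM /= [in X in _ = _ * X]expr2 rmorphM /= evrX.
Qed.

(** Both are recovered from their square by one polynomial, which interpolates the square root on
    the squares of a shared spectral list. *)
Lemma pos_sqrt_unique u v : pos_elt S u -> pos_elt S v -> u * u = v * v -> u = v.
Proof.
move=> pu pv uv; have [|L [uL pL HL]] := @common_spectrum [:: u; v].
  by move=> x; rewrite !inE => /orP[]/eqP ->.
have [p Hp] := interpolation (@Num.sqrt R) (undup_uniq (map (fun x => x ^+ 2) L)).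
suff E w : w \in [:: u; v] -> w = evr (w * w) p.
  transitivity (evr (u * u) p); first by apply: E; rewrite inE eqxx.
  by rewrite uv; apply/esym/E; rewrite !inE eqxx orbT.
move=> wuv; rewrite evr_sqr -{1}(evrX w).
apply: evr_spectrum_eq (HL w wuv) _ => x xL.
rewrite horner_comp hornerX hornerXn Hp; last first.
  by rewrite mem_undup; apply/mapP; exists x.
by rewrite sqrtr_sqr ger0_norm // pL.
Qed.

(** Injectivity allows 0 to be dropped from the spectral list; the inverse is then a polynomial
    interpolating [x^-1] on the remaining values. *)
Lemma pos_inv h : pos_elt S h -> (forall z, S z -> h * z = 0 -> z = 0) ->
  exists p, [/\ pos_elt S (evr h p), h * evr h p = 1 & evr h p * h = 1].
Proof.
move=> ph injh; have [L sL] := spectrum_exists ph.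
have [uL pL hL] := sL; have [Sh _ _] := ph.
pose M := rem 0 L.
have sM : spectrum_in h M.
  split; [exact: rem_uniq | by move=> x /mem_rem; apply: pL |].
  case: (boolP (0 \in L)) => L0; last by rewrite /M rem_id.
  apply: injh; first exact: sub_evr.
  by rewrite -{1}(evrX h) -rmorphM /= -hL (perm_big _ (perm_to_rem L0)) big_cons /= subr0.
have M0 x : x \in M -> x != 0.
  by rewrite /M mem_rem_uniq // !inE => /andP[].
have [uM _ _] := sM.
have [p Hp] := interpolation (fun x => x^-1) uM.
have hp : h * evr h p = 1.
  rewrite -{1}(evrX h) -rmorphM /= -(rmorph1 (evr h)).
  apply: evr_spectrum_eq sM _ => x xM.
  by rewrite hornerM hornerX Hp // hornerC divff // M0.
exists p; split=> //; last by rewrite -(evr_comm p (commr_refl h)).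
apply: pos_evr ph sM _ => x xM; rewrite Hp // invr_ge0 pL //.
exact: mem_rem xM.
Qed.

Lemma pos_conj z h : S z -> pos_elt S h -> pos_elt S (st z * h * z).
Proof.
move=> Sz [Sh hh ph]; split; first by do !apply: subM => //; apply: sub_st.
  by rewrite !stM stK hh mulrA.
move=> s Ss; have := ph (z * s) (subM Sz Ss).
by rewrite stM !mulrA.
Qed.

(** For a self-adjoint square root [q] of [h], the hypothesis says that [q s] has norm zero. *)
Lemma pos_eq0 h s : pos_elt S h -> S s -> tau (st s * h * s) = 0 -> h * s = 0.
Proof.
move=> ph Ss; have [p [[Sq qq _] q2]] := pos_sqrt ph.
rewrite -{1}q2 -{1}qq !mulrA -stM -mulrA => /(faith_eq0 (subM Sq Ss)) qs.
by rewrite -q2 -mulrA qs mulr0.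
Qed.

Lemma conjc_ge0 (z : R[i]) : 0 <= z -> z^* = z.
Proof. by move=> z0; apply: (@conj_Creal R[i] z); apply: ger0_real. Qed.

(** Positivity at [x + iota k] makes [k * tau (st x) + k^* * tau x] real for every scalar [k]; the
    values [k = 1] and [k = 'i] give the claim. *)
Lemma tau_star x : S x -> tau (st x) = (tau x)^*.
Proof.
move=> Sx.
have H k : (k * tau (st x) + k^*%C * tau x)^* = k * tau (st x) + k^*%C * tau x.
  have E : k * tau (st x) + k^*%C * tau x =
      tau (st (x + iota k) * (x + iota k))
      - tau (st x * x) - tau (st (iota k) * iota k).
    rewrite stD st_iota mulrDl !mulrDr -(iota_comm _ (st x)) !tauD !tau_iota.
    ring.
  have Sk := sub_iota k.
  by rewrite E !rmorphB /= !conjc_ge0 //; apply: faith_pos => //; apply: subD.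
have [ii i0 ci] : exists2 ii : R[i], ii != 0 & ii^*%C = - ii.
  exists 'i; first by rewrite eq_complex /= oner_eq0 andbF.
  by apply/eqP; rewrite eq_complex /= oppr0 !eqxx.
have := H 1; rewrite conjc1 !mul1r rmorphD /=.
have := H ii; rewrite ci rmorphD !rmorphM /= rmorphN /= ci.
set a := tau _; set b := tau _; set a' := a^*%C; set b' := b^*%C => H2 H1.
have {}H2 : b' - a' = a - b.
  by apply: (mulfI i0); move: H2; rewrite !mulrBr !mulNr opprK addrC.
have two0 : (2 : R[i]) != 0 by rewrite pnatr_eq0.
apply: (mulfI two0); rewrite -/b' -[RHS]/(2 * b').
have -> : 2 * a = (a + b) + (a - b) by ring.
by rewrite -H1 -H2; ring.
Qed.

End Subalgebra.

(* A maximal orthogonal family of N is a basis of N. *)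
Lemma orthogonal_projection (S N : set W) (x : W) :
    finite_dim S -> faithful_positive S -> star_subalgebra S ->
    star_subalgebra N -> N `<=` S ->
  exists2 D, N D & forall n, N n -> tau (st n * x) = tau (st n * D).
Proof.
move=> fdS faithS subS subN_ NS.
pose orth (e : nat -> W) k := forall i j : nat, (i < k)%N -> (j < k)%N ->
  [/\ N (e i), e i <> 0 & i != j -> tau (st (e i) * e j) = 0].
pose P k := `[< exists e, orth e k >].
have P0 : exists k, P k by exists 0%N; apply/asboolP; exists (fun=> 0).
have [b Hb] := fdS.
have norm0 y : N y -> y <> 0 -> tau (st y * y) != 0.
  by move=> Ny y0; apply/eqP => /(faith_eq0 faithS (NS _ Ny)).
have bound k : P k -> (k <= size b)%N.
  case/asboolP => e oe; rewrite leqNgt; apply/negP => ltk.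
  have [|v v0 Hv] := linear_dependence (x := fun i : 'I_k => e i) Hb ltk.
    by move=> i; have [/NS] := oe i i (ltn_ord i) (ltn_ord i).
  case/negP: v0; apply/eqP/rowP => j; rewrite mxE.
  have [Nj ej0 _] := oe j j (ltn_ord j) (ltn_ord j).
  apply: (mulIf (norm0 _ Nj ej0)); rewrite mul0r.
  have := congr1 (fun z => tau (st (e j) * z)) Hv; rewrite mulr0 tau0 => <-.
  rewrite mulr_sumr tau_sum (bigD1 j) //= big1 ?addr0 => [|i ij].
    by rewrite mulrA -iota_comm -mulrA tau_iota.
  have [_ _ /(_ _)H] := oe j i (ltn_ord j) (ltn_ord i).
  by rewrite mulrA -iota_comm -mulrA tau_iota H ?mulr0 // eq_sym.
have [k /asboolP[e oe] maxk] := ex_maxnP P0 bound.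
pose c y i := tau (st (e i) * y) / tau (st (e i) * e i).
pose proj y := \sum_(i < k) iota (c y i) * e i.
have Nproj y : N (proj y).
  apply: (sub_sum subN_) => i; have [Ni _ _] := oe i i (ltn_ord i) (ltn_ord i).
  exact/(subM subN_)/Ni/(sub_iota subN_).
have cproj y j : (j < k)%N -> tau (st (e j) * proj y) = tau (st (e j) * y).
  move=> jk; have [Nj ej0 _] := oe j j jk jk.
  rewrite /proj mulr_sumr tau_sum (bigD1 (Ordinal jk)) //= big1 ?addr0 => [|i ij].
    by rewrite mulrA -iota_comm -mulrA tau_iota /c divfK // norm0.
  have [_ _ H] := oe j i jk (ltn_ord i).
  by rewrite mulrA -iota_comm -mulrA tau_iota H ?mulr0 // eq_sym.
have projE n : N n -> n = proj n.
  move=> Nn; apply: contrapT => nproj.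
  pose n' := n - proj n.
  have Nn' : N n' by apply: (subB subN_).
  have n'0 : n' <> 0 by move/eqP; rewrite subr_eq0 => /eqP.
  have en' j : (j < k)%N -> tau (st (e j) * n') = 0.
    by move=> jk; rewrite mulrBr tauB cproj // subrr.
  have n'e j : (j < k)%N -> tau (st n' * e j) = 0.
    move=> jk; have [Nj _ _] := oe j j jk jk.
    rewrite -(stK (e j)) -stM (tau_star subS faithS) ?en' ?conjc0 //.
    by apply: (subM subS); [apply: (sub_st subS) | ]; apply: NS.
  (* Appending [n'] at index [k] contradicts the maximality of the family. *)
  have : P k.+1.
    apply/asboolP; exists (fun i => if (i < k)%N then e i else n') => i j.
    rewrite !ltnS => ik jk; case: ltnP => ik'; case: ltnP => jk'.
    - exact: oe.
    - by have [? ? _] := oe i i ik' ik'; split=> // _; apply: en'.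
    - by split=> // _; apply: n'e.
    - split=> // /eqP[]; apply/eqP; rewrite eqn_leq.
      by rewrite (leq_trans ik jk') (leq_trans jk ik').
  by move/maxk; rewrite ltnn.
exists (proj x); first exact: Nproj.
move=> n /projE ->; rewrite /proj.
rewrite (big_morph st stD st0) !mulr_suml !tau_sum; apply: eq_bigr => i _.
rewrite stM st_iota -(iota_comm _ (st (e i))) -!mulrA !tau_iota; congr (_ * _).
by rewrite -/(proj x) cproj.
Qed.
End Spectral.

(** * Clifford algebras and their conditional expectations *)

Section Clifford.
Context {R : realType} {U : cstarAlgType R} {K : eqType}.
Variable g : K -> U.
Local Notation iotaU := (GRing.in_alg U).

Lemma star1 : star (1 : U) = 1.
Proof. by rewrite -[LHS]mulr1 -{2}(starK 1) -starM mulr1 starK. Qed.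

Lemma star_algebraU : star_algebra iotaU (@star R U).
Proof.
split; [|exact: starK|exact: starD|exact: starM|].
- by move=> k x; rewrite /GRing.comm /= mulr_algl mulr_algr.
- by move=> k; rewrite /= starZ star1.
Qed.

Lemma starN (x : U) : star (- x) = - star x.
Proof. exact: stN star_algebraU x. Qed.

Hypothesis gst : forall k, star (g k) = g k.
Hypothesis gsq : forall k, g k * g k = 1.
Hypothesis gac : forall k l, k != l -> g k * g l = - (g l * g k).

Lemma gK k x : g k * (g k * x) = x.
Proof. by rewrite mulrA gsq mul1r. Qed.
Lemma gKr k x : x * g k * g k = x.
Proof. by rewrite -mulrA gsq mulr1. Qed.

(** The span of the ordered products of generators, peeled off one generator at a time; the
    components [x0] and [x1] drive the inductions below, and stability under products comes from
    anticommutation. *)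
Fixpoint clifford (s : seq K) : set U :=
  if s is k :: t then
    [set x | exists x0 x1, [/\ clifford t x0, clifford t x1 & x = x0 + g k * x1]]
  else range iotaU.

Lemma clifford_lin s (c : R[i]) x y :
  clifford s x -> clifford s y -> clifford s (c *: x + y).
Proof.
elim: s x y => [|k t IH] x y /=.
  move=> [a _ <-] [b _ <-]; exists (c * a + b) => //.
  by rewrite /= scalerDl scalerA.
move=> [x0 [x1 [Hx0 Hx1 ->]]] [y0 [y1 [Hy0 Hy1 ->]]].
exists (c *: x0 + y0), (c *: x1 + y1); split; [exact: IH|exact: IH|].
by rewrite scalerDr mulrDr scalerAr addrACA.
Qed.

Lemma clifford_iota s c : clifford s (iotaU c).
Proof.
elim: s c => [|k t IH] c; first by exists c.
by exists (iotaU c), (iotaU 0); split; rewrite // rmorph0 mulr0 addr0.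
Qed.

Lemma clifford0 s : clifford s 0.
Proof. by rewrite -(rmorph0 iotaU); apply: clifford_iota. Qed.

Lemma clifford1 s : clifford s 1.
Proof. by rewrite -(rmorph1 iotaU); apply: clifford_iota. Qed.

Lemma cliffordD s x y : clifford s x -> clifford s y -> clifford s (x + y).
Proof. by move=> ? ?; rewrite -[x]scale1r; apply: clifford_lin. Qed.

Lemma cliffordZ s c x : clifford s x -> clifford s (c *: x).
Proof. by move=> ?; rewrite -[_ *: _]addr0; apply/clifford_lin/clifford0. Qed.

Lemma cliffordN s x : clifford s x -> clifford s (- x).
Proof. by rewrite -scaleN1r; apply: cliffordZ. Qed.

Lemma clifford_gen_mul s j x : j \in s -> clifford s x -> clifford s (g j * x).
Proof.
elim: s x => // k t IH x; rewrite inE.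
case: (eqVneq j k) => [-> _|jk /= jt] [x0 [x1 [Hx0 Hx1 ->]]].
  by exists x1, x0; split; rewrite // mulrDr gK addrC.
exists (g j * x0), (- (g j * x1)); split; [exact: IH|exact/cliffordN/IH|].
by rewrite mulrDr mulrA gac // mulNr mulrN -mulrA.
Qed.

(** Two lists are used so that the induction on the left factor leaves [s] fixed. *)
Lemma clifford_mul_sub t s x y : {subset t <= s} ->
  clifford t x -> clifford s y -> clifford s (x * y).
Proof.
elim: t x => [|k t IH] x ts /=.
  by move=> [c _ <-] Hy; rewrite /= mulr_algl; apply: cliffordZ.
move=> [x0 [x1 [Hx0 Hx1 ->]]] Hy; rewrite mulrDl -mulrA.
have ts' : {subset t <= s} by move=> z zt; apply: ts; rewrite inE zt orbT.
apply: cliffordD; first exact: IH.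
by apply: clifford_gen_mul; [apply: ts; rewrite mem_head | apply: IH].
Qed.

Lemma clifford_sub t s : {subset t <= s} -> clifford t `<=` clifford s.
Proof.
by move=> ts x Hx; rewrite -[x]mulr1; apply: clifford_mul_sub ts Hx (clifford1 s).
Qed.

Lemma cliffordM s x y : clifford s x -> clifford s y -> clifford s (x * y).
Proof. exact: clifford_mul_sub. Qed.

Lemma clifford_gen s k : k \in s -> clifford s (g k).
Proof.
by move=> ks; rewrite -[g k]mulr1; apply: clifford_gen_mul ks (clifford1 s).
Qed.

Lemma clifford_star s x : clifford s x -> clifford s (star x).
Proof.
elim: s x => [|k t IH] x /=.
  move=> [c _ <-]; exists (c^*) => //; by rewrite /= starZ star1.
move=> [x0 [x1 [/IH Hx0 /IH Hx1 ->]]]; rewrite starD starM gst.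
have S : {subset t <= k :: t} by move=> z zt; rewrite inE zt orbT.
apply: (@cliffordD (k :: t)); first exact: (clifford_sub S).
apply: cliffordM; first exact: (clifford_sub S).
by apply: clifford_gen; rewrite mem_head.
Qed.

Lemma clifford_subalgebra s : star_subalgebra iotaU (@star R U) (clifford s).
Proof.
split; [exact: clifford_iota|exact: cliffordD|exact: cliffordM|exact: clifford_star].
Qed.

Lemma clifford_finite_dim s : finite_dim iotaU (clifford s).
Proof.
elim: s => [|k t [e IH]].
  exists [:: 1] => x [c _ <-]; exists (fun=> c).
  by rewrite big_ord1 /= mulr1.
exists (e ++ map ( *%R (g k)) e) => x [x0 [x1 [/IH[c0 E0] /IH[c1 E1] ->]]].
exists (fun i => if (i < size e)%N then c0 i else c1 (i - size e)%N).
rewrite size_cat size_map big_split_ord /=; congr (_ + _).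
  by rewrite E0; apply: eq_bigr => i _; rewrite nth_cat ltn_ord.
rewrite E1 mulr_sumr; apply: eq_bigr => i _.
rewrite nth_cat ltnNge leq_addr /= addKn (nth_map 0) //.
by rewrite !mulr_algl scalerAr.
Qed.

(** A generator outside [s] anticommutes with all those in [s], so conjugation by it is the parity
    automorphism of [clifford s], whichever one is chosen. *)
Lemma conj_gen_eq s k e x : k \notin s -> e \notin s -> clifford s x ->
  g k * x * g k = g e * x * g e.
Proof.
elim: s x => [|l t IH] x /=.
  by move=> _ _ [c _ <-] /=; rewrite !mulr_algr -!scalerAl !gsq.
rewrite !inE !negb_or => /andP[kl kt] /andP[el et] [x0 [x1 [Hx0 Hx1 ->]]].
rewrite !mulrDr !mulrDl (IH x0) //; congr (_ + _).
by rewrite !mulrA (gac kl) (gac el) !mulNr -!mulrA [g k * _]mulrA [g e * _]mulrA IH.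
Qed.

Definition flip e k x := g k * g e * x * g e * g k.

Lemma flip_lin e k c x y : flip e k (c *: x + y) = c *: flip e k x + flip e k y.
Proof. by rewrite /flip mulrDr !mulrDl -scalerAr -!scalerAl. Qed.

Lemma flipM e k x y : flip e k (x * y) = flip e k x * flip e k y.
Proof. by rewrite /flip !mulrA gKr gKr. Qed.

Lemma flip_star e k x : flip e k (star x) = star (flip e k x).
Proof. by rewrite /flip !starM !gst !mulrA. Qed.

(** Conjugation by [g e] agrees here with conjugation by [g k], which the outer factors undo. *)
Lemma flip_id e k s x : k \notin s -> e \notin s -> clifford s x -> flip e k x = x.
Proof.
move=> ks es Hx; rewrite /flip -!mulrA [g e * (x * _)]mulrA [g e * x * _]mulrA.
by rewrite -(conj_gen_eq ks es Hx) !mulrA gsq mul1r gKr.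
Qed.

Lemma flip_gen e k : k != e -> flip e k (g k) = - g k.
Proof.
move=> ke; rewrite /flip -(mulrA (g k)) -(opprK (g e * g k)) -gac //.
by rewrite mulrN mulrA gsq mul1r !mulNr gsq mul1r.
Qed.

Lemma flip_decomp e k t x0 x1 : k != e -> k \notin t -> e \notin t ->
  clifford t x0 -> clifford t x1 -> flip e k (x0 + g k * x1) = x0 - g k * x1.
Proof.
move=> ke kt et H0 H1; rewrite -[x0]scale1r flip_lin flipM flip_gen //.
by rewrite !(@flip_id e k t) // !scale1r mulNr.
Qed.

Section Trace.
Variable tau : U -> R[i].
Hypothesis tauP : tracial_state tau.

Lemma tauC x y : tau (x * y) = tau (y * x). Proof. by case: tauP. Qed.

Lemma tau_linear_form : linear_form iotaU tau.
Proof.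
case: tauP => -[lin _ _] _.
have l k x y : tau (k *: x + y) = k * tau x + tau y by exact: lin.
have t0 : tau 0 = 0.
  by have := l (-1) 0 0; rewrite scaler0 addr0 mulN1r addNr.
split=> [x y|k x]; first by rewrite -[x]scale1r l scale1r mul1r.
by rewrite /= mulr_algl -[_ *: _]addr0 l t0 addr0.
Qed.

Lemma tauZ k x : tau (k *: x) = k * tau x.
Proof. by rewrite -mulr_algl; case: tau_linear_form => _ ->. Qed.

Lemma tau_pos x : 0 <= tau (star x * x).
Proof. by case: tauP => -[_ H _] _; apply: H; exists x. Qed.

Lemma tau1 : tau 1 = 1. Proof. by case: tauP => -[]. Qed.

Lemma tau_flip e k x : tau (flip e k x) = tau x.
Proof. by rewrite /flip tauC !mulrA gsq mul1r tauC !mulrA gsq mul1r. Qed.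

(** Averaging over the flip, which preserves [tau], removes the cross terms of [x = x0 + g k * x1];
    hence [tau (star x * x)] is the sum of the same expressions at [x0] and [x1], and if it vanishes
    both do. *)
Lemma clifford_faithful e s : uniq (e :: s) ->
  faithful_positive (@star R U) tau (clifford s).
Proof.
move=> us; split; first by move=> x _; apply: tau_pos.
have tD x y := tauD tau_linear_form x y.
elim: s us => [_|k t IH] /=.
  move=> x [c _ <-] /=; rewrite starZ star1 -scalerAl mul1r scalerA.
  rewrite tauZ tau1 mulr1 => /eqP.
  rewrite mulf_eq0 => /orP[]/eqP.
    by move/(congr1 (@conjc R)); rewrite conjcK conjc0 => ->; rewrite scale0r.
  by move=> ->; rewrite scale0r.
rewrite inE negb_or => /andP[/andP[ek et] /andP[kt ut]].
move=> x [x0 [x1 [H0 H1 ->]]] tx.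
have ke : k != e by rewrite eq_sym.
have : tau (star x0 * x0) + tau (star x1 * x1) = 0.
  have two0 : (2 : R[i]) != 0 by rewrite pnatr_eq0.
  have E : flip e k (star (x0 + g k * x1) * (x0 + g k * x1)) =
           star (x0 - g k * x1) * (x0 - g k * x1).
    by rewrite flipM flip_star (flip_decomp ke kt et H0 H1).
  apply: (mulfI two0); rewrite mulr0 mulr_natl mulr2n -!tD -[RHS]addr0 -{1}tx -tx.
  rewrite -[in X in _ = _ + X](tau_flip e k) E -tD; congr tau.
  rewrite !starD !starN !starM !gst !mulrDr !mulrDl !mulrN !mulNr opprK.
  rewrite -[star x1 * g k * (g k * x1)]mulrA gK.
  set p := star x0 * x0; set q := star x1 * x1; set r := star x0 * _; set w := star x1 * _ * _.
  rewrite [RHS]addrACA [p + w + _]addrACA [r + q + _]addrACA !addrN addr0 add0r.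
  exact: addrACA.
move=> /eqP; rewrite paddr_eq0 ?tau_pos // => /andP[/eqP t0 /eqP t1].
rewrite (IH _ _ H0 t0) ?(IH _ _ H1 t1) ?mulr0 ?addr0 //=; by rewrite et.
Qed.
End Trace.

(** * Norm estimates and norm-closedness *)

Lemma cstar_norm0 : cstar_norm (0 : U) = 0.
Proof.
have := cstar_normZ 0 (0 : U); rewrite scale0r normr0 mul0r.
by move/(congr1 (@complex.Re R)).
Qed.

Lemma cstar_normZE (k : R[i]) (x : U) :
  cstar_norm (k *: x) = complex.Re `|k| * cstar_norm x.
Proof.
have := cstar_normZ k x; rewrite normc_def -rmorphM /= => /(congr1 (@complex.Re R)).
by [].
Qed.

Lemma cstar_normN (x : U) : cstar_norm (- x) = cstar_norm x.
Proof.
by rewrite -scaleN1r cstar_normZE normrN normr1 /= mul1r.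
Qed.

Lemma cstar_norm_ge0 (x : U) : 0 <= cstar_norm x.
Proof.
have := ler_cstar_normD x (- x); rewrite addrN cstar_norm0 cstar_normN.
by rewrite -mulr2n pmulrn_lge0.
Qed.

Lemma cstar_norm1 : cstar_norm (1 : U) = 1.
Proof.
have n0 : cstar_norm (1 : U) != 0.
  by apply/eqP => /(@cstar_norm0_eq0 R U)/eqP; rewrite oner_eq0.
apply: (mulfI n0); rewrite mulr1 -expr2 -cstar_norm_star star1 mulr1 //.
Qed.

Lemma cstar_norm_gen k : cstar_norm (g k) = 1.
Proof.
apply/eqP; rewrite -(@eqrXn2 _ 2) ?cstar_norm_ge0 //.
by rewrite -cstar_norm_star gst gsq cstar_norm1 expr1n.
Qed.

Lemma ler_cstar_norm_genl k (x : U) : cstar_norm (g k * x) <= cstar_norm x.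
Proof. by have := ler_cstar_normM (g k) x; rewrite cstar_norm_gen mul1r. Qed.

Lemma ler_cstar_norm_genr k (x : U) : cstar_norm (x * g k) <= cstar_norm x.
Proof. by have := ler_cstar_normM x (g k); rewrite cstar_norm_gen mulr1. Qed.

Lemma ler_norm_flip e k x : cstar_norm (flip e k x) <= cstar_norm x.
Proof.
apply: le_trans (ler_cstar_norm_genr _ _) _.
apply: le_trans (ler_cstar_norm_genr _ _) _; rewrite -mulrA.
by apply: le_trans (ler_cstar_norm_genl _ _) (ler_cstar_norm_genl _ _).
Qed.

(** Together with [flip_diff], this reads off the components [x0] and [x1] of [x0 + g k * x1]. *)
Definition flip_mean e k x := 2^-1 *: (x + flip e k x).
Definition flip_diff e k x := g k * (2^-1 *: (x - flip e k x)).

Lemma ler_norm_half x y : cstar_norm y <= cstar_norm x ->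
  cstar_norm (2^-1 *: (x + y) : U) <= cstar_norm x.
Proof.
move=> yx; have E : (2^-1 : R[i]) = (2^-1 : R)%:C by rewrite fmorphV rmorph_nat.
rewrite cstar_normZE E ger0_norm ?ler0c ?invr_ge0 ?ler0n //=.
rewrite mulrC ler_pdivrMr // mulr_natr mulr2n.
by apply: le_trans (ler_cstar_normD _ _) _; rewrite lerD2l.
Qed.

Lemma half_double (x : U) : 2^-1 *: (x + x) = x.
Proof. 
by rewrite -[x + x]mulr2n -(scaler_nat 2 x) scalerA mulVf ?scale1r // pnatr_eq0. Qed.

Lemma flip_mean_decomp e k t x0 x1 : k != e -> k \notin t -> e \notin t ->
  clifford t x0 -> clifford t x1 -> flip_mean e k (x0 + g k * x1) = x0.
Proof.
move=> ke kt et H0 H1; rewrite /flip_mean (flip_decomp ke kt et H0 H1).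
rewrite addrACA addrN addr0; exact: half_double.
Qed.

Lemma flip_diff_decomp e k t x0 x1 : k != e -> k \notin t -> e \notin t ->
  clifford t x0 -> clifford t x1 -> flip_diff e k (x0 + g k * x1) = x1.
Proof.
move=> ke kt et H0 H1; rewrite /flip_diff (flip_decomp ke kt et H0 H1).
rewrite opprB [x0 + _ + _]addrC addrA subrK half_double; exact: gK.
Qed.

(** Valid for every [x], hence for a limit not yet known to lie in the algebra. *)
Lemma flip_mean_diff e k x : x = flip_mean e k x + g k * flip_diff e k x.
Proof.
rewrite /flip_diff gK -scalerDr addrACA addrN addr0; exact/esym/half_double.
Qed.

Lemma cvg_norm_contract (f : U -> U) (u : nat -> U) (l : U) :
    {morph f : x y / x - y} -> (forall x, cstar_norm (f x) <= cstar_norm x) ->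
    cstar_norm (u n - l) @[n --> \oo] --> (0 : R) ->
  cstar_norm (f (u n) - f l) @[n --> \oo] --> (0 : R).
Proof.
move=> fB fn ul.
apply: (@squeeze_cvgr _ _ _ _ (fun=> 0) (fun n => cstar_norm (u n - l))).
- by apply: nearW => n; rewrite cstar_norm_ge0 /= -fB.
- exact: cvg_cst.
- exact: ul.
Qed.

Lemma flipB e k : {morph flip e k : x y / x - y}.
Proof. by move=> x y; rewrite addrC -scaleN1r flip_lin scaleN1r addrC. Qed.

(** The norm of [k *: 1] is the modulus of [k], so the real and imaginary parts of the coefficients
    are Cauchy sequences. *)
Lemma scalars_closed : norm_closed (range iotaU : set U).
Proof.
move=> u l Su ul.
pose c n : R[i] := sval (cid2 (Su n)).
have cE n : u n = c n *: 1 by rewrite /c; case: cid2 => k _ /= <-.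
have eps e : 0 < e -> exists N, forall n, (N <= n)%N -> cstar_norm (u n - l) < e.
  move=> e0; have /cvgr0_norm_lt/(_ _ e0)[N _ HN] := ul.
  exists N => n Nn; have := HN n Nn; rewrite /= ger0_norm //; exact: cstar_norm_ge0.
have normc k : cstar_norm (k *: 1 : U) = complex.Re `|k|.
  by rewrite cstar_normZE cstar_norm1 mulr1.
have reim (k : R[i]) : `|complex.Re k| <= complex.Re `|k| /\ `|complex.Im k| <= complex.Re `|k|
   /\ complex.Re `|k| <= `|complex.Re k| + `|complex.Im k|.
  rewrite normc_def /= -!sqrtr_sqr; split; first by rewrite ler_wsqrtr // lerDl sqr_ge0.
  split; first by rewrite ler_wsqrtr // lerDr sqr_ge0.
  rewrite -(ler_pXn2r (n := 2)) ?nnegrE ?addr_ge0 ?sqrtr_ge0 //.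
  rewrite sqr_sqrtr ?addr_ge0 ?sqr_ge0 // sqrrD !sqr_sqrtr ?sqr_ge0 //.
  by rewrite -addrA lerD2l lerDr mulrn_wge0 // mulr_ge0 ?sqrtr_ge0.
have dist m n : complex.Re `|c m - c n| <= cstar_norm (u m - l) + cstar_norm (u n - l).
  rewrite -normc scalerBl -!cE -[X in _ <= _ + X]cstar_normN opprB.
  by have := ler_cstar_normD (u m - l) (l - u n); rewrite addrA subrK.
have cau (f : R[i] -> R) : {morph f : x y / x - y} ->
    (forall k, `|f k| <= complex.Re `|k|) -> cvg (f (c n) @[n --> \oo]).
  move=> fB fk; apply/cauchy_cvgP/cauchy_exP => e e0.
  have e2 : 0 < e / 2 by rewrite divr_gt0.
  have [N HN] := eps _ e2; exists (f (c N)); exists N => // n /= Nn.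
  rewrite -ball_normE /= -fB; apply: le_lt_trans (fk _) _.
  apply: le_lt_trans (dist _ _) _; rewrite [e]splitr.
  by apply: ltrD; apply: HN.
have lima : cvg (complex.Re (c n) @[n --> \oo]).
  by apply: cau => [x y|k]; [case: x; case: y | have [] := reim k].
have limb : cvg (complex.Im (c n) @[n --> \oo]).
  by apply: cau => [x y|k]; [case: x; case: y | have [_ []] := reim k].
set a := lim _ in lima; set b := lim _ in limb.
exists (a +i* b) => //=; apply/eqP; rewrite -subr_eq0; apply/eqP.
apply: cstar_norm0_eq0; apply/eqP; rewrite eq_le cstar_norm_ge0 andbT.
apply/ler_addgt0Pl => e e0; rewrite addr0.
have e3 : 0 < e / 3 by rewrite divr_gt0.
have /cvgr_dist_lt/(_ _ e3)[N1 _ H1] := lima.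
have /cvgr_dist_lt/(_ _ e3)[N2 _ H2] := limb.
have [N3 H3] := eps _ e3.
(* At this index the real part, the imaginary part and [u n] itself are each within [e / 3] of their
   limits. *)
pose n := maxn N1 (maxn N2 N3).
have {}H1 := H1 n (leq_maxl _ _).
have {}H2 : `|b - complex.Im (c n)| < e / 3.
  by apply: H2; rewrite /= /n leq_max leq_max leqnn orbT.
have {}H3 := H3 n; rewrite /n !leq_max leqnn !orbT in H3.
have {}H3 := H3 isT; rewrite -/n in H3.
have -> : (a +i* b) *: 1 - l = ((a +i* b) - c n) *: 1 + (u n - l).
  by rewrite scalerBl -cE addrA subrK.
apply: le_trans (ler_cstar_normD _ _) _; rewrite normc.
have [_ [_ H]] := reim ((a +i* b) - c n).
apply: le_trans (lerD H (ltW H3)) _.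
have -> : complex.Re ((a +i* b) - c n) = a - complex.Re (c n) by case: (c n).
have -> : complex.Im ((a +i* b) - c n) = b - complex.Im (c n) by case: (c n).
by rewrite /= in H1; lra.
Qed.

(** The two components depend on the element through linear maps that do not increase the norm, so
    they converge too, and by induction their limits lie in [clifford t]. *)
Lemma clifford_norm_closed e s : uniq (e :: s) -> norm_closed (clifford s).
Proof.
elim: s => [_|k t IH] /=; first exact: scalars_closed.
rewrite inE negb_or => /andP[/andP[ek et] /andP[kt ut]] u l Su ul.
have ke : k != e by rewrite eq_sym.
have {}IH := IH _; have cl : norm_closed (clifford t) by apply: IH; rewrite /= et.
exists (flip_mean e k l), (flip_diff e k l); split; last exact: flip_mean_diff.
- apply: (cl (fun n => flip_mean e k (u n))).
    by move=> n; have [x0 [x1 [H0 H1 ->]]] := Su n; rewrite (flip_mean_decomp ke kt et H0 H1).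
  apply: cvg_norm_contract ul => [x y|x].
    by rewrite /flip_mean flipB -scalerBr; congr (_ *: _); rewrite opprD addrACA.
  by apply: ler_norm_half; apply: ler_norm_flip.
- apply: (cl (fun n => flip_diff e k (u n))).
    by move=> n; have [x0 [x1 [H0 H1 ->]]] := Su n; rewrite (flip_diff_decomp ke kt et H0 H1).
  apply: cvg_norm_contract ul => [x y|x].
    rewrite /flip_diff flipB -mulrBr -scalerBr; congr (_ * (_ *: _)).
    by rewrite !opprD !opprK addrACA.
  apply: le_trans (ler_cstar_norm_genl _ _) _; apply: ler_norm_half.
  by rewrite cstar_normN; apply: ler_norm_flip.
Qed.

(** * Conditional expectations, parity and commutants *)

Definition cond_exp e (ks : seq K) (x : U) : U := foldr (flip_mean e) x ks.

Lemma flip_mean_lin e k c x y :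
  flip_mean e k (c *: x + y) = c *: flip_mean e k x + flip_mean e k y.
Proof.
by rewrite /flip_mean flip_lin addrACA -(scalerDr c) (scalerDr 2^-1) !scalerA [c * _]mulrC.
Qed.

Lemma cond_exp_lin e ks c x y :
  cond_exp e ks (c *: x + y) = c *: cond_exp e ks x + cond_exp e ks y.
Proof. by elim: ks => //= k ks ->; rewrite flip_mean_lin. Qed.

Lemma cond_exp_star e ks x : cond_exp e ks (star x) = star (cond_exp e ks x).
Proof.
have E : Num.conj (2^-1 : R[i]) = 2^-1.
  by apply: conj_Creal; rewrite ger0_real // invr_ge0 ler0n.
by elim: ks => //= k ks ->; rewrite /flip_mean flip_star starZ starD E.
Qed.

(** Every flip involved is multiplicative and fixes [clifford s] pointwise. *)
Lemma cond_exp_modl e ks s a x : uniq (e :: ks ++ s) -> clifford s a ->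
  cond_exp e ks (a * x) = a * cond_exp e ks x.
Proof.
elim: ks => //= k ks IH; rewrite inE mem_cat !negb_or => /andP[/andP[ek]].
move=> /andP[eks es] /andP[]; rewrite mem_cat negb_or => /andP[kks ks'] us Ha.
rewrite IH //; last by rewrite mem_cat negb_or eks es.
by rewrite /flip_mean flipM (flip_id ks' es Ha) -mulrDr scalerAr.
Qed.

Lemma cond_exp_modr e ks s a x : uniq (e :: ks ++ s) -> clifford s a ->
  cond_exp e ks (x * a) = cond_exp e ks x * a.
Proof.
move=> us Ha; apply: (inv_inj (@starK R U)).
rewrite -cond_exp_star !starM -cond_exp_star.
exact: cond_exp_modl us (clifford_star Ha).
Qed.

(** The induction generalizes [s]: the inner expectation lands in [clifford (k :: s)], from which
    the last mean deletes [g k]. *)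
Lemma clifford_cond_exp e ks s x : uniq (e :: ks ++ s) -> clifford (ks ++ s) x ->
  clifford s (cond_exp e ks x).
Proof.
elim: ks s => //= k ks IH s; rewrite inE mem_cat !negb_or => /andP[/andP[ek]].
move=> /andP[eks es] /andP[]; rewrite mem_cat negb_or => /andP[kks ks'] us Hx.
have ke : k != e by rewrite eq_sym.
have uks : uniq (e :: ks ++ k :: s).
  have /perm_uniq -> : perm_eq (e :: ks ++ k :: s) (e :: k :: ks ++ s).
    by rewrite perm_cons (perm_catCA ks [:: k] s).
  by rewrite /= inE !mem_cat !negb_or ek eks es kks ks' us.
have Hks : clifford (ks ++ k :: s) x.
  by apply: (@clifford_sub (k :: ks ++ s)) Hx => z; rewrite !inE !mem_cat inE orbCA.
have [x0 [x1 [H0 H1 ->]]] := IH _ uks Hks.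
by rewrite (flip_mean_decomp ke ks' es H0 H1).
Qed.

(** Evenness is expressed through an outside generator as [g e * y * g e = y], and conjugation by
    [g k] acts on [y] in the same way. *)
Lemma even_gen_comm s k e y : k \notin s -> e \notin s -> clifford s y ->
  g e * y * g e = y -> g k * y = y * g k.
Proof.
move=> ks es Hy ey; rewrite -[LHS](gKr k) (conj_gen_eq ks es Hy) ey //.
Qed.

Lemma even_comm t s e x y : {in t, forall k, k \notin s} -> e \notin s ->
  clifford t x -> clifford s y -> g e * y * g e = y -> x * y = y * x.
Proof.
move=> + es + Hy ey; elim: t x => [|k t IH] x ts /=.
  by move=> [c _ <-] /=; rewrite mulr_algl mulr_algr.
have ts' : {in t, forall k, k \notin s} by move=> z zt; apply: ts; rewrite inE zt orbT.
move=> [x0 [x1 [H0 H1 ->]]]; rewrite mulrDl mulrDr (IH _ ts' H0); congr (_ + _).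
by rewrite -mulrA (IH _ ts' H1) !mulrA (even_gen_comm (ts k (mem_head _ _)) es Hy ey).
Qed.

(** Conjugation by [g e] fixes the even [y], and so does conjugation by [g k]; hence the flips of
    [ks] fix it, and so does the expectation deleting [ks]. *)
Lemma commutant_clifford e ks s y : uniq (e :: ks ++ s) -> clifford (ks ++ s) y ->
  g e * y * g e = y -> {in ks, forall k, g k * y = y * g k} -> clifford s y.
Proof.
move=> us Hy ey gy; suff <- : cond_exp e ks y = y by apply: clifford_cond_exp.
elim: {us Hy} ks gy => //= k ks IH gy; rewrite IH; last first.
  by move=> z zk; apply: gy; rewrite inE zk orbT.
rewrite /flip_mean /flip -!mulrA [g e * (y * _)]mulrA [g e * y * _]mulrA ey.
by rewrite mulrA gy ?mem_head // gKr half_double.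
Qed.

Lemma tau_cond_exp tau e ks x : tracial_state tau -> tau (cond_exp e ks x) = tau x.
Proof.
move=> tauP; elim: ks => //= k ks IH.
rewrite /flip_mean tauZ // (tauD (tau_linear_form tauP)) tau_flip // IH.
by rewrite -[tau x + _]mulr2n -(mulr_natl (tau x)) mulrA mulVf ?mul1r // pnatr_eq0.
Qed.

(** Parity is inner once a generator outside the region is at hand: both sides are multiplicative
    and negate the generators in [s]. *)
Lemma parity_gen_conj (Theta : {lrmorphism U -> U}) e s x :
  (forall k, Theta (g k) = - g k) -> e \notin s -> clifford s x ->
  Theta x = g e * x * g e.
Proof.
move=> Tg; elim: s x => [|k t IH] x /=.
  move=> _ [c _ <-] /=.
  by rewrite linearZ /= rmorph1 mulr_algr -scalerAl gsq.
rewrite inE negb_or => /andP[ek et] [x0 [x1 [H0 H1 ->]]].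
rewrite rmorphD rmorphM /= Tg (IH x0) // (IH x1) // mulrDr mulrDl; congr (_ + _).
by rewrite !mulrA (gac ek) !mulNr.
Qed.
End Clifford.

(** * Majorana generators of the local algebras *)

Section LocalAlgebra.
Context {R : realType} {U : cstarAlgType R}.
Variable a : int -> U.
Hypothesis CARa : CAR_algebra a.

(** Twice the real part of [a k.1], or minus twice its imaginary part; with this normalization each
    one squares to 1. *)
Definition majorana (k : int * bool) : U :=
  if k.2 then 'i *: (a k.1 - star (a k.1)) else a k.1 + star (a k.1).

Lemma majorana_star k : star (majorana k) = majorana k.
Proof.
case: k => i [] /=; rewrite /majorana /=; last by rewrite starD starK addrC.
rewrite starZ starD starN starK.
have -> : Num.conj ('i : R[i]) = - 'i by apply/eqP; rewrite eq_complex /= oppr0 !eqxx.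
by rewrite scaleNr -scalerN opprD opprK addrC.
Qed.

Let car0 i j : a i * a j + a j * a i = 0. Proof. by case: CARa. Qed.
Let car1 i j : a i * star (a j) + star (a j) * a i = (i == j)%:R.
Proof. by case: CARa. Qed.
Let car0' i j : star (a i) * star (a j) + star (a j) * star (a i) = 0.
Proof.
have := congr1 (@star R U) (car0 j i); rewrite starD !starM.
by rewrite (st0 (star_algebraU (U := U))).
Qed.

Let ac (x y : U) := x * y + y * x.
Let acC x y : ac x y = ac y x. Proof. exact: addrC. Qed.
Let acDl x y z : ac (x + y) z = ac x z + ac y z.
Proof. by rewrite /ac mulrDl mulrDr addrACA. Qed.
Let acZl c x y : ac (c *: x) y = c *: ac x y.
Proof. by rewrite /ac -scalerAl -scalerAr scalerDr. Qed.

Lemma majorana_anticomm k l :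
  majorana k * majorana l + majorana l * majorana k = (k == l)%:R *+ 2.
Proof.
rewrite -/(ac _ _).
have acN x y : ac (- x) y = - ac x y by rewrite -scaleN1r acZl scaleN1r.
have E0 i j : ac (a i) (a j) = 0 by exact: car0.
have E1 i j : ac (star (a i)) (star (a j)) = 0 by exact: car0'.
have E2 i j : ac (a i) (star (a j)) = (i == j)%:R by exact: car1.
have E3 i j : ac (star (a i)) (a j) = (i == j)%:R by rewrite acC E2 eq_sym.
have ii : ('i * 'i : R[i]) = -1 by rewrite -expr2 sqr_i.
case: k l => i b [j c]; rewrite /majorana /= xpair_eqE.
have S x0 y0 z0 w0 : ac (x0 + y0) (z0 + w0) = (ac x0 z0 + ac x0 w0) + (ac y0 z0 + ac y0 w0).
  by rewrite acDl ![ac _ (z0 + w0)]acC !acDl ![ac z0 _]acC ![ac w0 _]acC.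
have NR x y : ac x (- y) = - ac x y by rewrite acC acN acC.
have ZR c' x y : ac x (c' *: y) = c' *: ac x y by rewrite acC acZl acC.
case: b c => [] [] /=; rewrite ?acZl ?ZR S ?NR ?acN ?NR ?E0 ?E1 ?E2 ?E3 ?oppr0 ?opprK ?add0r ?addr0.
- by rewrite scalerA ii scaleN1r andbT opprD opprK -mulr2n.
- by rewrite addrN scaler0 andbF mul0rn.
- by rewrite addNr scaler0 andbF mul0rn.
- by rewrite andbT -mulr2n.
Qed.

Lemma majorana_sq k : majorana k * majorana k = 1.
Proof.
have := majorana_anticomm k k; rewrite eqxx -mulr2n => E.
by rewrite -(half_double (_ * _)) -mulr2n E mulr2n half_double.
Qed.

Lemma majorana_ac k l : k != l -> majorana k * majorana l = - (majorana l * majorana k).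
Proof.
move=> /negbTE kl; have := majorana_anticomm k l; rewrite kl mul0rn.
by move/eqP; rewrite addr_eq0 => /eqP.
Qed.

Definition majorana_sites (s : seq int) : seq (int * bool) :=
  [seq (i, b) | i <- s, b <- [:: false; true]].

Lemma mem_majorana_sites s k : (k \in majorana_sites s) = (k.1 \in s).
Proof.
case: k => i b; apply/allpairsP/idP => [[[j c] /= [js _ [-> _]]] //|/= si].
by exists (i, b); split=> //; case: b.
Qed.

Lemma majorana_sites_uniq s : uniq s -> uniq (majorana_sites s).
Proof.
move=> us; apply: allpairs_uniq => //.
by move=> [x y] [z w].
Qed.

Lemma majorana_sites_cat s t :
  majorana_sites (s ++ t) = majorana_sites s ++ majorana_sites t.
Proof. by elim: s => //= i s IH; rewrite /majorana_sites /= -[flatten _]/(majorana_sites _) IH. Qed.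

(** The Clifford algebra is a norm-closed star-subalgebra containing the [a i]; conversely a
    star-subalgebra containing the [a i] contains the Majorana elements and what they generate. The
    outside generator [e] serves the norm-closedness. *)
Lemma local_algebraE s e (I : set int) : uniq s -> e \notin majorana_sites s ->
  I = [set` s] -> local_algebra a I = clifford majorana (majorana_sites s).
Proof.
move=> us es ->; set C := clifford majorana _.
have ue : uniq (e :: majorana_sites s) by rewrite /= es majorana_sites_uniq.
apply/seteqP; split.
  apply: smallest_sub; last first.
    move=> _ [i /= si <-].
    have m b : (i, b) \in majorana_sites s by rewrite mem_majorana_sites.
    have -> : a i = 2^-1 *: (majorana (i, false) + (- 'i) *: majorana (i, true)).
      rewrite /majorana /= scalerA mulNr -expr2 sqr_i opprK scale1r.
      by rewrite addrACA addrN addr0 half_double.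
    apply/cliffordZ/cliffordD; first exact: clifford_gen majorana_sq majorana_ac _ _ (m _).
    by apply/cliffordZ/(clifford_gen majorana_sq majorana_ac)/m.
  split.
  - exact: clifford1.
  - by move=> k x y; apply: clifford_lin.
  - by move=> x y; apply: cliffordM majorana_sq majorana_ac _ _ _.
  - by move=> x; apply: clifford_star majorana_star majorana_sq majorana_ac _ _.
  - exact: clifford_norm_closed majorana_star majorana_sq majorana_ac _ _ ue.
move=> x Cx B [[B1 Blin BM Bst _] aB].
have BZ k y : B y -> B (k *: y).
  by move=> By; have B0 := Blin (-1) _ _ By By; rewrite scaleN1r addNr in B0;
     rewrite -[_ *: _]addr0; apply: Blin.
have BD y z : B y -> B z -> B (y + z) by move=> ? ?; rewrite -[y]scale1r; apply: Blin.
have Bg k : k \in majorana_sites s -> B (majorana k).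
  rewrite mem_majorana_sites; case: k => i b /= si.
  have Ba : B (a i) by apply: aB; exists i.
  rewrite /majorana; case: b => /=; last exact/BD/Bst.
  by apply/BZ/BD => //; rewrite -scaleN1r; apply/BZ/Bst.
rewrite /C in Cx; elim: (majorana_sites s) x Bg Cx => [|k t IH] x Bg /=.
  by move=> [c _ <-]; apply: BZ.
have Bg' : forall k, k \in t -> B (majorana k).
  by move=> z zt; apply: Bg; rewrite inE zt orbT.
move=> [x0 [x1 [H0 H1 ->]]]; apply: BD; first exact: IH.
by apply: BM; [apply: Bg; rewrite mem_head | apply: IH].
Qed.
End LocalAlgebra.

(** * Positivity of matrices over a finite-dimensional star-subalgebra *)

Section MatrixPositivity.
Context {R : realType}.

Lemma finite_dim_family (W : nzRingType) (iota : {rmorphism R[i] -> W}) (S : set W)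
    (T : finType) (b : T -> W) :
  (forall x, S x -> exists c : T -> R[i], x = \sum_t iota (c t) * b t) ->
  finite_dim iota S.
Proof.
move=> H; exists [seq b t | t <- index_enum T] => x /H[c ->].
exists (fun i => nth 0 [seq c t | t <- index_enum T] i).
rewrite size_map big_tnth; apply: eq_bigr => i _.
set t := tnth _ i.
have ti : nth t (index_enum T) i = t by rewrite [RHS](tnth_nth t).
by rewrite !(nth_map t) ?ltn_ord // ti.
Qed.

Context {U : cstarAlgType R} {n : nat}.
Variables (S : set U) (tau : U -> R[i]).
Local Notation iotaU := (GRing.in_alg U).
Hypothesis subS : star_subalgebra iotaU (@star R U) S.
Hypothesis fdS : finite_dim iotaU S.
Hypothesis faithS : faithful_positive (@star R U) tau S.
Hypothesis linT : linear_form iotaU tau.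

Local Notation M := 'M[U]_n.+1.

Definition iota_mx : {rmorphism R[i] -> M} := (@scalar_mx U n.+1) \o iotaU.
Definition star_mx (X : M) : M := map_mx star X^T.
Definition trace_mx (X : M) : R[i] := \sum_i tau (X i i).
Definition sub_mx : set M := [set X | forall i j, S (X i j)].

Let algU := star_algebraU (U := U).

Lemma star_mxM (X Y : M) : star_mx (X * Y) = star_mx Y * star_mx X.
Proof.
apply/matrixP => i j; rewrite !mxE (big_morph _ (stD algU) (st0 algU)).
by apply: eq_bigr => k _; rewrite !mxE starM.
Qed.

Lemma star_algebra_mx : star_algebra iota_mx star_mx.
Proof.
split.
- move=> k X; apply/matrixP => i j; rewrite /iota_mx /= !mxE (bigD1 j) //= big1 => [|l lj].
    rewrite (bigD1 i) //= big1 => [|l li]; rewrite !mxE ?eqxx ?mulr1n ?addr0 /=.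
      by rewrite mulr_algl mulr_algr.
    by rewrite eq_sym (negbTE li) mulr0n mul0r.
  by rewrite !mxE (negbTE lj) mulr0n mulr0.
- by move=> X; apply/matrixP => i j; rewrite !mxE starK.
- by move=> X Y; apply/matrixP => i j; rewrite !mxE starD.
- exact: star_mxM.
- move=> k; apply/matrixP => i j; rewrite !mxE eq_sym.
  by case: (i == j); rewrite ?mulr1n ?mulr0n; [apply: (st_iota algU)|apply: (st0 algU)].
Qed.

Lemma iota_mxE k (X : M) i j : (iota_mx k * X) i j = k *: X i j.
Proof.
by rewrite /iota_mx /= -[_ * X]/(_ *m X) mul_scalar_mx mxE mulr_algl.
Qed.

Lemma trace_mx_linear : linear_form iota_mx trace_mx.
Proof.
split=> [X Y|k X]; rewrite /trace_mx.
  by rewrite -big_split; apply: eq_bigr => i _; rewrite mxE (tauD linT).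
rewrite mulr_sumr; apply: eq_bigr => i _.
by rewrite iota_mxE -(tau_iota linT) /= mulr_algl.
Qed.

Lemma sub_mx_subalgebra : star_subalgebra iota_mx star_mx sub_mx.
Proof.
split=> [k|X Y HX HY|X Y HX HY|X HX] i j; rewrite !mxE.
- case: (i == j); rewrite ?mulr1n ?mulr0n; first exact: (sub_iota subS).
  exact: (sub_zero subS).
- exact: (subD subS).
- by apply: (sub_sum subS) => k; apply: (subM subS).
- exact: (sub_st subS).
Qed.

Lemma sub_mx_finite_dim : finite_dim iota_mx sub_mx.
Proof.
case: fdS => e He.
apply: (@finite_dim_family _ _ _ ('I_n.+1 * 'I_n.+1 * 'I_(size e))%type
  (fun t => e`_t.2 *: delta_mx t.1.1 t.1.2)) => X HX.
pose c (p : 'I_n.+1 * 'I_n.+1) := sval (cid (He _ (HX p.1 p.2))).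
have cE p : X p.1 p.2 = \sum_(i < size e) iotaU (c p i) * e`_i.
  by rewrite /c; case: cid.
exists (fun t : 'I_n.+1 * 'I_n.+1 * 'I_(size e) => c t.1 t.2); apply/matrixP => i j.
rewrite (cE (i, j)) /= summxE.
rewrite -(pair_bigA _ (fun (p : 'I_n.+1 * 'I_n.+1) (l : 'I_(size e)) => (iota_mx (c p l) *
   (e`_l *: delta_mx p.1 p.2)) i j)) /= (bigD1 (i, j)) //= [X in _ + X]big1 ?addr0 => [|p pij].
  by apply: eq_bigr => l _; rewrite iota_mxE !mxE !eqxx mulr1 mulr_algl.
apply: big1 => l _; rewrite iota_mxE !mxE.
case: eqP => [ip|_]; case: eqP => [jp|_]; rewrite ?mulr0 ?scaler0 //.
by case: p ip jp pij => a b /= <- <-; rewrite eqxx.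
Qed.

(** The squared norm of a matrix is computed entrywise, so [trace_mx] inherits positivity and
    faithfulness from [tau]. *)
Lemma trace_mx_sqr (X : M) : trace_mx (star_mx X * X) =
  \sum_i \sum_k tau (star (X k i) * X k i).
Proof.
apply: eq_bigr => i _; rewrite mxE (tau_sum linT).
by apply: eq_bigr => k _; rewrite !mxE.
Qed.

Lemma trace_mx_faithful : faithful_positive star_mx trace_mx sub_mx.
Proof.
have pos X : sub_mx X -> forall i k, 0 <= tau (star (X k i) * X k i).
  by move=> HX i k; apply: (faith_pos faithS).
split=> X HX; rewrite trace_mx_sqr.
  by apply: sumr_ge0 => i _; apply: sumr_ge0 => k _; apply: pos.
move/eqP; rewrite psumr_eq0 => [|i _]; last by apply: sumr_ge0 => k _; apply: pos.
move=> /allP H; apply/matrixP => k i; rewrite mxE.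
have := H i (mem_index_enum _).
rewrite psumr_eq0 => [/allP/(_ k (mem_index_enum _))/eqP|l _]; last exact: pos.
exact: (faith_eq0 faithS).
Qed.

(** The functional calculus in the matrix algebra turns the quadratic-form condition into a
    self-adjoint square root of [X] with entries in [S]. *)
Lemma positive_mxP (X : M) : sub_mx X -> star_mx X = X ->
  (forall Y, sub_mx Y -> 0 <= trace_mx (star_mx Y * X * Y)) ->
  positive_mx_in S X.
Proof.
move=> HX sX pX.
have [p [[HZ sZ _] ZZ]] := pos_sqrt star_algebra_mx trace_mx_linear
  sub_mx_subalgebra sub_mx_finite_dim trace_mx_faithful (And3 HX sX pX).
move: HZ sZ ZZ; move: (evr _ _ _) => Z HZ sZ ZZ; exists Z; first exact: HZ.
by rewrite -ZZ -{1}sZ.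
Qed.
End MatrixPositivity.

(** * Factorizations of densities *)

Section StarSubalgebras.
Context {R : realType} {U : cstarAlgType R}.
Variable tau : U -> R[i].
Hypothesis tauP : tracial_state tau.
Local Notation iotaU := (GRing.in_alg U).
Local Notation subalg := (star_subalgebra iotaU (@star R U)).
Local Notation pos := (pos_elt (@star R U) tau).
Let algU := star_algebraU (U := U).
Let linT := tau_linear_form tauP.

Variable S : set U.
Hypothesis subS : subalg S.
Hypothesis fdS : finite_dim iotaU S.
Hypothesis faithS : faithful_positive (@star R U) tau S.

Let pos_sqrtS := pos_sqrt algU linT subS fdS faithS.
Let pos_invS := pos_inv algU linT subS fdS faithS.

(** The square root of [h] is a polynomial in [h], so it lies in every star-subalgebra containing
    [h]. *)
Lemma pos_positive_in (T : set U) h : subalg T -> T h -> pos S h -> positive_in T h.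
Proof.
move=> subT Th /pos_sqrtS[p [[_ sp _] pp]]; exists (evr algU h p).
  exact: sub_evr.
by rewrite sp pp.
Qed.

Lemma positive_in_pos (T : set U) h : T `<=` S -> positive_in T h -> pos S h.
Proof. by move=> TS [z /TS Sz ->]; apply: (pos_star algU subS). Qed.

Lemma tau_nondegenerate x y : S x -> S y ->
  (forall z, S z -> tau (x * z) = tau (y * z)) -> x = y.
Proof.
move=> Sx Sy xy; apply/eqP; rewrite -subr_eq0; apply/eqP.
have Sd := subB subS Sx Sy; have Sd' := sub_st subS Sd.
apply: (inv_inj (@starK R U)); rewrite (st0 algU).
apply: (faith_eq0 faithS Sd'); rewrite starK mulrBl (tauB linT).
by rewrite xy // subrr.
Qed.

(** Here [q = h^(1/2)] and [r = h^(-1/2)]; as polynomials in [h] they lie in the same subalgebras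
    and commute with whatever commutes with [h]. *)
Lemma pos_injective_inv h : pos S h -> (forall z, S z -> h * z = 0 -> z = 0) ->
  exists q r, [/\ pos S q, pos S r, q * q = h, q * r = 1 & r * q = 1] /\
    [/\ forall T, subalg T -> T h -> T q, forall T, subalg T -> T h -> T r,
        forall u, GRing.comm u h -> GRing.comm u q &
        forall u, GRing.comm u h -> GRing.comm u r].
Proof.
move=> ph inj; have [p [pq qq]] := pos_sqrtS ph; have [Sh _ _] := ph.
have [|p' [pr qr rq]] := pos_invS pq.
  by move=> z Sz qz; apply: inj => //; rewrite -qq -mulrA qz mulr0.
exists (evr algU h p), (evr algU (evr algU h p) p'); split=> //; split.
- by move=> T subT Th; exact: (sub_evr algU subT).
- by move=> T subT Th; apply/(sub_evr _ subT)/(sub_evr _ subT).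
- by move=> u; apply: evr_comm.
- by move=> u uh; apply/evr_comm/evr_comm.
Qed.

(** * Even factors from geometric means *)

Section EvenFactorization.
Variables (Theta : {lrmorphism U -> U}) (S1 S2 : set U).
Hypotheses (sub1 : subalg S1) (sub2 : subalg S2).
Hypothesis Thst : forall x, Theta (star x) = star (Theta x).
Hypotheses (ThS : forall x, S x -> S (Theta x))
  (Th1 : forall x, S1 x -> S1 (Theta x)) (Th2 : forall x, S2 x -> S2 (Theta x)).
Hypothesis ThK : forall x, S x -> Theta (Theta x) = x.

Lemma evr_morph h p : Theta (evr algU h p) = evr algU (Theta h) p.
Proof.
elim/poly_ind: p => [|p c IH]; first by rewrite !rmorph0.
rewrite !rmorphD !rmorphM /= !evrX !evrC IH.
by rewrite [Theta (iotaU _)]linearZ /= rmorph1.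
Qed.

Lemma pos_morph h : pos S h -> pos S (Theta h).
Proof.
move=> /pos_sqrtS[p [[Sq sq _] <-]]; rewrite -{1}sq rmorphM /= Thst.
by apply: (pos_star algU subS) => //; apply: ThS.
Qed.

Variables x y : U.
Hypotheses (px : pos S x) (py : pos S y) (S1x : S1 x) (S2y : S2 y).
Hypotheses (xy : x * y = y * x) (even_xy : Theta (x * y) = x * y).
Hypothesis inj_xy : forall z, S z -> x * y * z = 0 -> z = 0.

(* With b = x^-1 Theta x and s = b^(1/2), the factor x s is the geometric mean of x
   and Theta x; both s and the inverse square root acting on y are one and the same
   polynomial p in b and in its inverse b'. *)
Lemma even_factorization : exists x' y',
  [/\ positive_in S1 x', positive_in S2 y', Theta x' = x', Theta y' = y'
    & x * y = x' * y'].
Proof.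
have [Sx stx _] := px; have [Sy sty _] := py.
have [|q [r [[pq pr qq qr rq] [+ + _ _]]]] := pos_injective_inv px.
  by move=> z Sz xz; apply: inj_xy => //; rewrite xy -mulrA xz mulr0.
move=> /(_ S1 sub1 S1x) S1q /(_ S1 sub1 S1x) S1r.
have [|w [v [[pw pv ww wv vw] [+ + _ _]]]] := pos_injective_inv py.
  by move=> z Sz yz; apply: inj_xy => //; rewrite -mulrA yz mulr0.
move=> /(_ S2 sub2 S2y) S2w /(_ S2 sub2 S2y) S2v.
have [Sq sq _] := pq; have [Sr sr _] := pr; have [Sw sw _] := pw; have [Sv sv _] := pv.
have qrK z : z * q * r = z by rewrite -mulrA qr mulr1.
have rqK z : z * r * q = z by rewrite -mulrA rq mulr1.
have wvK z : z * w * v = z by rewrite -mulrA wv mulr1.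
have vwK z : z * v * w = z by rewrite -mulrA vw mulr1.
have Tqr : Theta q * Theta r = 1 by rewrite -rmorphM qr rmorph1.
have Trq : Theta r * Theta q = 1 by rewrite -rmorphM rq rmorph1.
have Twv : Theta w * Theta v = 1 by rewrite -rmorphM wv rmorph1.
have Tvw : Theta v * Theta w = 1 by rewrite -rmorphM vw rmorph1.
have TqrK z : z * Theta q * Theta r = z by rewrite -mulrA Tqr mulr1.
have TrqK z : z * Theta r * Theta q = z by rewrite -mulrA Trq mulr1.
have TwvK z : z * Theta w * Theta v = z by rewrite -mulrA Twv mulr1.
have TvwK z : z * Theta v * Theta w = z by rewrite -mulrA Tvw mulr1.
have Tx : Theta x = Theta q * Theta q by rewrite -qq rmorphM.
have Ty : Theta y = Theta w * Theta w by rewrite -ww rmorphM.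
pose b := r * r * Theta x.
pose b' := Theta y * v * v.
(* Evenness gives [Theta x Theta y = x y], that is [Theta y y^-1 = (Theta x)^-1 x]. *)
have b'E : b' = Theta r * Theta r * x.
  have := even_xy; rewrite rmorphM /= => E.
  have <- : x * y * v * v = x by rewrite -ww !mulrA !wvK.
  by rewrite -E Tx !mulrA TrqK Trq mul1r.
have bb' : b * b' = 1.
  by rewrite /b b'E Tx -qq !mulrA !TqrK rqK rq.
have b'b : b' * b = 1.
  by rewrite /b b'E Tx -qq !mulrA !qrK TrqK Trq.
(* [b] and [b'] need not be self-adjoint, but [b] is similar to the positive [P1], and [b'] to both
   [P1i] and [P3]; a polynomial giving square roots of these three also gives square roots of [b]
   and [b']. *)
pose P1 := r * Theta x * r.
pose P1i := q * (Theta r * Theta r) * q.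
pose P3 := v * Theta y * v.
have pP1 : pos S P1.
  by rewrite /P1 -{1}sr; apply: (pos_conj algU subS) => //; apply: pos_morph.
have prr : pos S (r * r) by rewrite -{1}sr; apply: (pos_star algU subS).
have pP1i : pos S P1i.
  by rewrite /P1i -{1}sq; apply: (pos_conj algU subS) => //; rewrite -rmorphM; apply: pos_morph.
have pP3 : pos S P3.
  by rewrite /P3 -{1}sv; apply: (pos_conj algU subS) => //; apply: pos_morph.
have P1P1i : P1 * P1i = 1.
  by rewrite /P1 /P1i Tx !mulrA rqK !TqrK rq.
have P1iP1 : P1i * P1 = 1.
  by rewrite /P1 /P1i Tx !mulrA qrK !TrqK qr.
have [|p Hp] := common_sqrt algU linT subS fdS faithS (hs := [:: P1; P1i; P3]).
  by move=> h; rewrite !inE => /or3P[]/eqP ->.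
have {Hp}[[pt tt] [pu uu] [pk _]] : [/\ pos S (evr algU P1 p) /\ evr algU P1 p * evr algU P1 p = P1,
    pos S (evr algU P1i p) /\ evr algU P1i p * evr algU P1i p = P1i &
    pos S (evr algU P3 p) /\ evr algU P3 p * evr algU P3 p = P3].
  by split; apply: Hp; rewrite !inE eqxx ?orbT.
pose s := evr algU b p; pose s' := evr algU b' p.
have sE : s = r * evr algU P1 p * q.
  rewrite (evr_intertwine algU (k := b)) ?rqK //.
  by rewrite /b /P1 !mulrA.
have s'E : s' = r * evr algU P1i p * q.
  rewrite (evr_intertwine algU (k := b')) ?rqK //.
  by rewrite /P1i b'E -qq !mulrA rq mul1r qrK.
have s'E2 : s' = w * evr algU P3 p * v.
  rewrite (evr_intertwine algU (k := b')) ?wvK //.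
  by rewrite /P3 /b' !mulrA wv mul1r vwK.
move: (evr algU P1 p) (evr algU P1i p) (evr algU P3 p) pt tt pu uu pk sE s'E s'E2.
move=> t u k pt tt pu uu pk sE s'E s'E2.
have [|p' [pti tti tit]] := pos_invS pt.
  by move=> z Sz tz; rewrite -[z]mul1r -P1iP1 -tt -!mulrA tz !mulr0.
(* [u] and the inverse of [t] are positive square roots of the same element [P1i]. *)
have uti : u = evr algU t p'.
  apply: (pos_sqrt_unique algU linT subS fdS faithS pu pti).
  rewrite uu; move: (evr _ _ _) tti tit => ti tti tit.
  have : ti * ti * P1 * P1i = ti * ti by rewrite -mulrA P1P1i mulr1.
  by rewrite -tt !mulrA -[ti * ti * t]mulrA tit mulr1 tit mul1r /P1i !mulrA.
rewrite -uti in tti tit.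
have ss' : s * s' = 1 by rewrite sE s'E !mulrA qrK -[r * t * u]mulrA tti mulr1 rq.
have s's : s' * s = 1 by rewrite sE s'E !mulrA qrK -[r * u * t]mulrA tit mulr1 rq.
have ssb : s * s = b by rewrite sE !mulrA qrK -[r * t * t]mulrA tt /P1 /b !mulrA rqK.
have s's'b : s' * s' = b'.
  have E1 : s * s * (s' * s') = 1 by rewrite mulrA -[s * s * s']mulrA ss' mulr1 ss'.
  by rewrite -[LHS]mul1r -b'b -ssb -[LHS]mulrA E1 mulr1.
have Tb : Theta b = b'.
  by rewrite b'E /b !rmorphM /= ThK.
have Tb' : Theta b' = b by rewrite -Tb ThK // /b; do !apply: (subM subS) => //; apply: ThS.
have Ts : Theta s = s' by rewrite /s evr_morph Tb.
have Ts' : Theta s' = s by rewrite /s' evr_morph Tb'.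
have xb : x * b = Theta x by rewrite /b -qq !mulrA qrK qr mul1r.
have b'y : b' * y = Theta y by rewrite /b' -ww !mulrA vwK vwK.
have S1b : S1 b by rewrite /b; do !apply: (subM sub1) => //; apply: Th1.
have S2b' : S2 b' by rewrite /b'; do !apply: (subM sub2) => //; apply: Th2.
(* [Theta] exchanges [s] and [s'], so [Theta (x s) = x b s' = x s], and similarly for [s' y];
   positivity comes from [x s = q t q] and [s' y = w k w]. *)
exists (x * s), (s' * y); split.
- apply: (pos_positive_in sub1); first by apply: (subM sub1) => //; exact: (sub_evr algU sub1).
  have -> : x * s = star q * t * q by rewrite sE sq -qq !mulrA qrK.
  exact: (pos_conj algU subS).
- apply: (pos_positive_in sub2); first by apply: (subM sub2) => //; exact: (sub_evr algU sub2).
  have -> : s' * y = star w * k * w by rewrite s'E2 sw -ww !mulrA vwK.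
  exact: (pos_conj algU subS).
- by rewrite rmorphM /= Ts -xb -ssb !mulrA -[x * s * s * s']mulrA ss' mulr1.
- by rewrite rmorphM /= Ts' -b'y -s's'b !mulrA ss' mul1r.
- by rewrite !mulrA -[x * s * s']mulrA ss' mulr1.
Qed.
End EvenFactorization.

Lemma finite_dim_sub (T : set U) : T `<=` S -> finite_dim iotaU T.
Proof. by move=> TS; case: fdS => e He; exists e => z /TS; apply: He. Qed.

Lemma faithful_positive_sub (T : set U) : T `<=` S ->
  faithful_positive (@star R U) tau T.
Proof.
move=> TS; case: faithS => p0 e0.
by split=> z /TS; [apply: p0 | apply: e0].
Qed.

(** * An expectation from a commuting factorization *)

Section Expectation.
Variables (S1 S2 S3 SA : set U) (F : U -> U).
Hypotheses (sub1 : subalg S1) (sub2 : subalg S2) (sub3 : subalg S3).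
Hypotheses (S1S : S1 `<=` S) (S2S : S2 `<=` S) (S31 : S3 `<=` S1) (S32 : S3 `<=` S2)
  (SA1 : SA `<=` S1).
Hypotheses (F_lin : forall (c : R[i]) x y, F (c *: x + y) = c *: F x + F y)
  (F_star : forall x, F (star x) = star (F x))
  (F1 : forall x, S x -> S1 (F x)) (F2 : forall x, S2 x -> S3 (F x))
  (F_modl : forall z x, S1 z -> F (z * x) = z * F x)
  (F_modr : forall z x, S1 z -> F (x * z) = F x * z)
  (F_tau : forall x, tau (F x) = tau x).

Variables x y : U.
Hypotheses (px : pos S x) (py : pos S y) (S1x : S1 x) (S2y : S2 y).
Hypotheses (xy : x * y = y * x).
Hypothesis inj_xy : forall z, S z -> x * y * z = 0 -> z = 0.
Hypothesis SAy : forall z, SA z -> GRing.comm z y.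

(** The image of [star_mx Z * Z] is tested against [Y]: as [F] is a bimodule map preserving the
    trace, it disappears under [tau], and what remains is the squared norm of [Z * Y'] with
    [Y' = w v Y]. *)
Lemma completely_positive_sandwich v w : star v = v -> star w = w ->
  S1 v -> S2 w -> completely_positive S S1 (fun z => v * F (w * z * w) * v).
Proof.
move=> sv sw S1v S2w; pose E z := v * F (w * z * w) * v.
have ES z : S z -> S1 (E z).
  move=> Sz; apply: (subM sub1) => //; apply: (subM sub1) => //; apply: F1.
  by apply: (subM subS); [apply: (subM subS) => //|]; apply: S2S.
split=> // [k z t _ _|].
  by rewrite mulrDr mulrDl -scalerAr -scalerAl F_lin mulrDr mulrDl -scalerAr -scalerAl.
(* Square matrices form a nonzero ring only in positive size, so the empty matrix is treated
   apart. *)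
case=> [|n] X [Z SZ XE].
  by exists 0 => [[]//|]; apply/matrixP => -[].
have SXij i j : S (X i j).
  rewrite XE !mxE; apply: (sub_sum subS) => k; rewrite !mxE.
  by apply: (subM subS) => //; apply: (sub_st subS).
have XsX : star_mx X = X.
  by rewrite XE -[_ *m _]/(star_mx Z * Z) star_mxM /star_mx; congr (_ * _);
     apply/matrixP => i j; rewrite !mxE starK.
apply: (positive_mxP sub1 (finite_dim_sub S1S) (faithful_positive_sub S1S) linT).
- by move=> i j; rewrite mxE; apply: ES.
- apply/matrixP => i j; rewrite !mxE -{2}XsX !mxE !starM -F_star !starM sv sw.
  by rewrite !mulrA.
move=> Y SY; pose Y' : 'M[U]_n.+1 := map_mx (fun u => w * v * u) Y.
have -> : trace_mx tau (star_mx Y * map_mx E X * Y) = trace_mx tau (star_mx (Z * Y') * (Z * Y')).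
  have -> : star_mx (Z * Y') * (Z * Y') = star_mx Y' * X * Y'.
    by rewrite star_mxM XE -!mulrA.
  apply: eq_bigr => i _; rewrite !mxE !(tau_sum linT); apply: eq_bigr => k _.
  rewrite !mxE !mulr_suml !(tau_sum linT); apply: eq_bigr => l _.
  rewrite !mxE !starM sv sw /E.
  have S1Yk : S1 (v * Y k i) by apply: (subM sub1).
  have S1Yl : S1 (star (Y l i) * v) by apply: (subM sub1) => //; apply: (sub_st sub1).
  rewrite !mulrA -(mulrA _ v (Y k i)) -F_modl // -F_modr // F_tau.
  by rewrite !mulrA.
rewrite trace_mx_sqr //; apply: sumr_ge0 => i _; apply: sumr_ge0 => k _.
exact: tau_pos.
Qed.

Lemma expectation_exists : exists E : U -> U,
  [/\ completely_positive S S1 E /\ E 1 = 1,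
      forall z u, SA z -> S u -> E (z * u) = z * E u,
      forall z, S z -> tau (x * y * E z) = tau (x * y * z)
    & forall z, S2 z -> S3 (E z)].
Proof.
have [Sx stx _] := px; have [Sy sty _] := py.
have inj_y z : S z -> y * z = 0 -> z = 0.
  by move=> Sz yz; apply: inj_xy => //; rewrite -mulrA yz mulr0.
have [w [_ [[pw _ ww _ _] [+ _ wc _]]]] := pos_injective_inv py inj_y.
move=> /(_ S2 sub2 S2y) S2w; have [Sw sw _] := pw.
pose h := F y.
have S3S : S3 `<=` S by move=> z /S32; apply: S2S.
have S3h : S3 h by apply: F2.
have tauh s : S3 s -> tau (star s * h * s) = tau (star s * y * s).
  move=> /S31 S1s; have S1s' := sub_st sub1 S1s.
  by rewrite /h -F_modl // -F_modr // F_tau.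
have ph : pos S3 h.
  split=> //; first by rewrite /h -F_star sty.
  move=> s S3s; rewrite tauh //; have [_ _] := py; apply; exact: S3S.
have fd3 := finite_dim_sub S3S; have ff3 := faithful_positive_sub S3S.
(* If [h z = 0] then [tau (star z * y * z) = 0], so [y z = 0]: injectivity passes from [y] to
   [h]. *)
have injh z : S3 z -> h * z = 0 -> z = 0.
  move=> S3z hz; apply: inj_y; first exact: S3S.
  apply: (pos_eq0 algU linT subS fdS faithS py); first exact: S3S.
  by rewrite -tauh // -mulrA hz mulr0 (tau0 linT).
have [p1 [phi hhi hih]] := pos_inv algU linT sub3 fd3 ff3 ph injh.
set hi := evr algU h p1 in phi hhi hih.
have [p2 [pv vv]] := pos_sqrt algU linT sub3 fd3 ff3 phi.
set v := evr algU hi p2 in pv vv.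
have comm_v u : GRing.comm u h -> GRing.comm u v.
  by move=> uh; apply: evr_comm; apply: evr_comm.
have [S3v sv _] := pv; have S1v := S31 S3v.
have vhv : v * h * v = 1.
  by rewrite -[v * h](comm_v h (commr_refl h)) -mulrA vv.
(* Both products are values of [F], at [x y] and at [y x]. *)
have xh : GRing.comm x h by rewrite /GRing.comm /h -F_modl // xy F_modr.
have xv := comm_v _ xh.
have xw : GRing.comm x w by apply: wc; rewrite /GRing.comm.
exists (fun z => v * F (w * z * w) * v); split.
- split; first exact: completely_positive_sandwich.
  by rewrite mulr1 ww vhv.
- move=> z u SAz Su; have S1z := SA1 SAz.
  have zw : GRing.comm z w by apply: wc; apply: SAy.
  have zv : GRing.comm z v.
    by apply: comm_v; rewrite /GRing.comm /h -F_modl // SAy // F_modr.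
  by rewrite (mulrA w) -zw -!(mulrA z) F_modl // mulrA -zv !mulrA.
- move=> z Sz; set G := F _.
  have S1G : S1 G by apply: F1; do !apply: (subM subS) => //.
  have S1u : S1 (v * G * v) by do !apply: (subM sub1).
  have S1ux : S1 (v * G * v * x) by apply: (subM sub1).
  (* Against an element of [S1] the expectation replaces [y] by [h]; then [v h v = 1] leaves
     [tau (x G) = tau (x w z w)], and [x] commutes with [w]. *)
  have -> : tau (x * y * (v * G * v)) = tau (h * (v * G * v * x)).
    by rewrite /h -F_modr // F_tau -mulrA (tauC tauP) !mulrA.
  have -> : tau (h * (v * G * v * x)) = tau (x * G).
    have -> : h * (v * G * v * x) = (h * v * G) * (v * x) by rewrite !mulrA.
    rewrite (tauC tauP) -xv.
    have -> : x * v * (h * v * G) = x * (v * h * v) * G by rewrite !mulrA.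
    by rewrite vhv mulr1.
  rewrite -F_modl // F_tau !mulrA (tauC tauP) !mulrA -xw -(mulrA x) ww //.
- move=> z S2z; apply: (subM sub3) => //; apply: (subM sub3) => //; apply: F2.
  by do !apply: (subM sub2).
Qed.
End Expectation.

(** * Fixed points of a Markov expectation and the resulting factorization *)

Section Factorization.
Variables (Theta : {lrmorphism U -> U}) (S1 SA : set U) (E : U -> U) (rho : U).
Hypotheses (sub1 : subalg S1) (S1S : S1 `<=` S) (SAS : SA `<=` S).
Hypotheses (ThS : forall x, S x -> S (Theta x)) (Th1 : forall x, S1 x -> S1 (Theta x))
  (ThK : forall x, S x -> Theta (Theta x) = x)
  (Thtau : forall x, S x -> tau (Theta x) = tau x).
Hypotheses (prho : pos S rho) (inj_rho : forall z, S z -> rho * z = 0 -> z = 0)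
  (Thrho : Theta rho = rho).
Hypotheses (E_cp : completely_positive S S1 E) (E_one : E 1 = 1)
  (E_mod : forall x y, SA x -> S y -> E (x * y) = x * E y)
  (E_inv : forall x, S x -> tau (rho * E x) = tau (rho * x)).

Let phi z := tau (rho * z).

Let linPhi : linear_form iotaU phi.
Proof.
split=> [x y|k x]; rewrite /phi; first by rewrite mulrDr (tauD linT).
by rewrite /= mulr_algl -scalerAr (tauZ tauP).
Qed.

Let phiE z : phi (star z * z) = tau (star (star z) * rho * star z).
Proof. by rewrite /phi starK mulrA (tauC tauP) mulrA. Qed.

Let faithPhi : faithful_positive (@star R U) phi S.
Proof.
split=> z Sz; rewrite phiE; have Sz' := sub_st subS Sz.
  by case: prho => _ _; apply.
move=> /(pos_eq0 algU linT subS fdS faithS prho Sz') /(inj_rho Sz') z0.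
by rewrite -[z]starK z0 (st0 algU).
Qed.

Let phi_star x : S x -> phi (star x) = (phi x)^*%C.
Proof. exact: (tau_star algU linPhi subS faithPhi). Qed.

Let E1 z : S z -> S1 (E z). Proof. by case: E_cp => H _ _; apply: H. Qed.
Let ES z : S z -> S (E z). Proof. by move/E1/S1S. Qed.
Let E_lin k x y : S x -> S y -> E (k *: x + y) = k *: E x + E y.
Proof. by case: E_cp => _ H _; apply: H. Qed.
Let SZ k x : S x -> S (k *: x).
Proof. by move=> Sx; rewrite -mulr_algl; apply: (subM subS) => //; apply: (sub_iota subS). Qed.

(* Complete positivity of E at the 2 x 2 matrix Z^* Z with Z = [[z, 1], [0, 0]]. *)
Let two_positive z : S z -> exists p q r t,
  [/\ S p /\ S q, S r /\ S t, E (star z * z) = star p * p + star q * q,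
      E (star z) = star p * r + star q * t &
      E z = star r * p + star t * q /\ 1 = star r * r + star t * t].
Proof.
move=> Sz; pose zz (i : 'I_2) := if i == 0 then z else 1.
pose Z : 'M[U]_2 := \matrix_(i, j) (if i == 0 then zz j else 0).
have SZij i j : S (Z i j).
  rewrite mxE /zz; case: ifP => _; last exact: (sub_zero subS).
  by case: ifP => _ //; exact: (sub_one subS).
case: E_cp => _ _ /(_ 2%N (map_mx star Z^T *m Z)) [|W SW WE]; first by exists Z.
have key i j : E (star (zz i) * zz j) = star (W 0 i) * W 0 j + star (W 1 i) * W 1 j.
  have := congr1 (fun M : 'M[U]_2 => M i j) WE.
  rewrite !mxE !big_ord_recl !big_ord0 !addr0 !mxE /=.
  have -> : lift ord0 ord0 = 1 :> 'I_2 by apply/val_inj.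
  by rewrite mulr0 addr0.
exists (W 0 0), (W 1 0), (W 0 1), (W 1 1).
have S1W i j : S (W i j) by apply: S1S.
have := key 0 0; have := key 0 1; have := key 1 0; have := key 1 1.
by rewrite /zz /= !mulr1 !star1 !mul1r E_one => <- -> -> ->.
Qed.

Let E_star z : S z -> E (star z) = star (E z).
Proof.
move=> /two_positive[p [q [r [t [_ _ _ -> [-> _]]]]]].
by rewrite starD !starM !starK.
Qed.

(** The Kadison-Schwarz inequality: with [c = E z], the difference [E (star z * z) - star c * c] is
    a sum of two squares, and [phi] is invariant under [E]. *)
Let E_schwarz z : S z -> phi (star (E z) * E z) <= phi (star z * z).
Proof.
move=> Sz; have [p [q [r [t [[Sp Sq] [Sr St] E2 Es [Ez one]]]]]] := two_positive Sz.
set c := E z; have Sc : S c by apply: ES.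
have H : star (p - r * c) * (p - r * c) + star (q - t * c) * (q - t * c) =
    E (star z * z) - star c * c.
  have sqB (x y : U) : star (x - y * c) * (x - y * c) =
      star x * x - star x * y * c - star c * (star y * x) + star c * (star y * y) * c.
    rewrite starD starN starM mulrBl !mulrBr opprB !mulrA -[RHS]addrA.
    by congr (_ + _); apply: addrC.
  rewrite !sqB E2 -/c.
  have AC (x y u v x' y' u' v' : U) : (x - y - u + v) + (x' - y' - u' + v') =
      (x + x') - (y + y') - (u + u') + (v + v').
    by rewrite !opprD addrACA; congr (_ + _); rewrite addrACA; congr (_ + _); apply: addrACA.
  rewrite AC -!mulrDl -!mulrDr -Es -one -Ez mulr1 E_star // -/c.
  by rewrite subrK.
have Sc' : S (star c * c) by apply: (subM subS) => //; apply: (sub_st subS).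
have Sz' : S (star z * z) by apply: (subM subS) => //; apply: (sub_st subS).
have pT u : S u -> 0 <= phi (star u * u) by exact: (faith_pos faithPhi).
have <- : phi (E (star z * z)) = phi (star z * z) by apply: E_inv.
rewrite -subr_ge0 -(tauB linPhi) -H (tauD linPhi) addr_ge0 // pT //.
  by apply: (subB subS) => //; apply: (subM subS).
by apply: (subB subS) => //; apply: (subM subS).
Qed.

Let phi_pos z : S z -> 0 <= phi (star z * z).
Proof. exact: (faith_pos faithPhi). Qed.

Let SstM x y : S x -> S y -> S (star x * y).
Proof. by move=> Sx Sy; apply: (subM subS) => //; apply: (sub_st subS). Qed.

Let fixed z := S z /\ E z = z.

Let fixed_star z : fixed z -> fixed (star z).
Proof. by move=> [Sz Ez]; split; [apply: (sub_st subS)|rewrite E_star // Ez]. Qed.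

(* E is a contraction for <x, y> = phi (x^* y); perturbing a fixed point n by t z and
   letting t vary gives <z, n> = <E z, n>. *)
Let fixed_adjoint n z : fixed n -> S z -> phi (star (E z) * n) = phi (star z * n).
Proof.
move=> [Sn En] Sz; have Sz' := ES Sz.
pose c := phi (star z * n) - phi (star (E z) * n).
pose d := phi (star z * z) - phi (star (E z) * E z).
have d0 : 0 <= d by rewrite subr_ge0; apply: E_schwarz.
have expand t w : S w -> phi (star (n + t *: w) * (n + t *: w)) =
    phi (star n * n) + t * (phi (star w * n))^*%C + t^*%C * phi (star w * n)
     + t^*%C * t * phi (star w * w).
  move=> Sw.
  have -> : star (n + t *: w) * (n + t *: w) = star n * n + t^*%C *: (star w * n) +
      (t *: (star n * w) + t *: (t^*%C *: (star w * w))).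
    by rewrite starD starZ mulrDr !mulrDl -!scalerAr -!scalerAl.
  have phiZ k u : phi (k *: u) = k * phi u by rewrite -mulr_algl (tau_iota linPhi).
  have <- : phi (star n * w) = (phi (star w * n))^*%C.
    by rewrite -phi_star ?starM ?starK //; apply: SstM.
  rewrite !(tauD linPhi) !phiZ; ring.
have key t : 0 <= t * c^*%C + t^*%C * c + t^*%C * t * d.
  have := E_schwarz (subD subS Sn (SZ t Sz)).
  have -> : E (n + t *: z) = n + t *: E z.
    by rewrite addrC E_lin // En addrC.
  rewrite -subr_ge0 !expand // /c /d rmorphB /= => H.
  apply: le_trans H _; rewrite le_eqVlt; apply/orP; left; apply/eqP; ring.
have d1 : 0 < d + 1 by rewrite ltr_wpDl // ltr01.
have d1' : d + 1 != 0 by rewrite gt_eqF.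
have dc : (d + 1)^*%C = d + 1 by apply: conjc_ge0; apply: ltW.
(* For [d > 0] the minimum over [t] is at [- c / d]; the denominator [d + 1] also covers [d = 0] and
   still yields a negative multiple of the squared modulus of [c]. *)
have := key (- c / (d + 1)).
have -> : (- c / (d + 1))^*%C = - c^*%C / (d + 1).
  by rewrite rmorphM rmorphN /= fmorphV /= dc.
have -> : - c / (d + 1) * c^*%C + - c^*%C / (d + 1) * c + - c^*%C / (d + 1) * (- c / (d + 1)) * d =
   - (c * c^*%C * ((d + 2) / (d + 1) ^+ 2)).
  by field.
rewrite oppr_ge0 => H; have q0 : 0 < (d + 2) / (d + 1) ^+ 2.
  by rewrite divr_gt0 ?exprn_gt0 // ltr_wpDl.
have cc0 : c * c^*%C = 0.
  apply/eqP; rewrite eq_le; move: H; rewrite pmulr_lle0 // => ->.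
  by rewrite -[X in _ <= X]normCK exprn_ge0.
have c0 : c = 0.
  by move/eqP: cc0; rewrite mulf_eq0 conjc_eq0 orbb => /eqP.
by apply/eqP; rewrite eq_sym -subr_eq0 -/c c0.
Qed.

(** The squared norm of [E m - m] is that of [E m] minus that of [m], and [E] is a contraction. *)
Let adjoint_fixed m : S m -> (forall z, S z -> phi (star m * E z) = phi (star m * z)) ->
  E m = m.
Proof.
move=> Sm mE; have SEm := ES Sm; apply/eqP; rewrite -subr_eq0; apply/eqP.
apply: (faith_eq0 faithPhi); first exact: (subB subS).
have e1 := mE m Sm.
have e2 : phi (star (E m) * m) = phi (star m * m).
  have -> : star (E m) * m = star (star m * E m) by rewrite starM starK.
  rewrite phi_star; last exact: SstM.
  rewrite e1; apply: conjc_ge0; exact: phi_pos.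
have SEmm := subB subS SEm Sm.
apply/eqP; rewrite eq_le phi_pos // andbT.
rewrite starD starN mulrBr !mulrBl !(tauB linPhi) e1 e2 subrr subr0 subr_le0.
exact: E_schwarz.
Qed.

Variable ri : U.
Hypotheses (Sri : S ri) (rir : ri * rho = 1) (rri : rho * ri = 1).

Let Srho : S rho. Proof. by case: prho. Qed.
Let st_rho : star rho = rho. Proof. by case: prho. Qed.
Let st_ri : star ri = ri.
Proof.
by rewrite -[star ri]mulr1 -rri mulrA -{1}st_rho -starM rri star1 mul1r.
Qed.

(** By [phi (star (rho * m * ri) * u) = phi (u * star m)], the element [rho * m * ri] is fixed by
    the adjoint of [E] when [star m] is fixed by [E]; the other half follows by taking stars. *)
Let fixed_modular n : fixed n -> fixed (rho * n * ri) /\ fixed (ri * n * rho).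
Proof.
have H m : fixed m -> fixed (rho * m * ri).
  move=> fm; have fs := fixed_star fm; have [Sm Em] := fm.
  have Sm' : S (rho * m * ri) by do 2!apply: (subM subS) => //.
  split=> //; apply: adjoint_fixed => // z Sz.
  have E0 u : phi (star (rho * m * ri) * u) = phi (u * star m).
    rewrite !starM st_rho st_ri /phi !mulrA rri mul1r -!mulrA (tauC tauP).
    by rewrite !mulrA.
  have Sz' := sub_st subS Sz.
  by rewrite !E0 -[E z]starK -E_star // -[z in RHS]starK; apply: fixed_adjoint.
move=> fn; split; first exact: H.
have := fixed_star (H _ (fixed_star fn)).
by rewrite !starM starK st_rho st_ri mulrA.
Qed.

(** The algebra [N] of the outline; imposing all powers at once makes its stability a shift of
    exponents. *)
Let modular_core : set U := [set z | forall k,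
  S1 (ri ^+ k * z * rho ^+ k) /\ S1 (rho ^+ k * z * ri ^+ k)].

Let rirX k : ri ^+ k * rho ^+ k = 1.
Proof.
elim: k => [|k IH]; first by rewrite !expr0 mulr1.
by rewrite exprSr exprS mulrA -(mulrA _ ri) rir mulr1.
Qed.

Let rriX k : rho ^+ k * ri ^+ k = 1.
Proof.
elim: k => [|k IH]; first by rewrite !expr0 mulr1.
by rewrite exprSr exprS mulrA -(mulrA _ rho) rri mulr1.
Qed.

Let st_exp (x : U) k : star x = x -> star (x ^+ k) = x ^+ k.
Proof.
move=> xx; elim: k => [|k IH]; first by rewrite expr0 star1.
by rewrite [in LHS]exprS starM IH xx -exprSr.
Qed.

Let core_subalg : subalg modular_core.
Proof.
have iotaX u v c : u * v = 1 -> u * iotaU c * v = iotaU c.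
  by move=> uv; rewrite /= mulr_algr -scalerAl uv.
split=> [c|x y Nx Ny|x y Nx Ny|x Nx] k.
- by rewrite !iotaX //; split; apply: (sub_iota sub1).
- have [Nx1 Nx2] := Nx k; have [Ny1 Ny2] := Ny k.
  by rewrite !mulrDr !mulrDl; split; apply: (subD sub1).
- have [Nx1 Nx2] := Nx k; have [Ny1 Ny2] := Ny k; split.
    have -> : ri ^+ k * (x * y) * rho ^+ k =
      (ri ^+ k * x * rho ^+ k) * (ri ^+ k * y * rho ^+ k).
      by rewrite !mulrA -[_ * rho ^+ k * ri ^+ k]mulrA rriX mulr1.
    exact: (subM sub1).
  have -> : rho ^+ k * (x * y) * ri ^+ k =
    (rho ^+ k * x * ri ^+ k) * (rho ^+ k * y * ri ^+ k).
    by rewrite !mulrA -[_ * ri ^+ k * rho ^+ k]mulrA rirX mulr1.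
  exact: (subM sub1).
- have [/(sub_st sub1) + /(sub_st sub1)] := Nx k.
  by rewrite !starM !(st_exp _ st_rho) !(st_exp _ st_ri) !mulrA.
Qed.

Let core_sub : modular_core `<=` S1.
Proof. by move=> z /(_ 0%N)[]; rewrite !expr0 mul1r mulr1. Qed.

Let core_modular z : modular_core z ->
  modular_core (ri * z * rho) /\ modular_core (rho * z * ri).
Proof.
move=> Nz; split=> k.
  split; first by have [+ _] := Nz k.+1; rewrite exprSr exprS !mulrA.
  (* A positive exponent drops by one through cancellation; at exponent 0 the claim is the first
     power of the opposite conjugation. *)
  case: k => [|k]; first by have [+ _] := Nz 1%N; rewrite !expr0 !expr1 mul1r mulr1.
  have [_] := Nz k; rewrite exprSr exprS !mulrA -[_ * rho * ri]mulrA rri mulr1.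
  by rewrite -[_ * rho * ri]mulrA rri mulr1.
split; last by have [_] := Nz k.+1; rewrite exprSr exprS !mulrA.
case: k => [|k]; first by have [_] := Nz 1%N; rewrite !expr0 !expr1 mul1r mulr1.
have [+ _] := Nz k; rewrite exprSr exprS !mulrA -[_ * ri * rho]mulrA rir mulr1.
by rewrite -[_ * ri * rho]mulrA rir mulr1.
Qed.

(** From [E a = a E 1 = a], all modular conjugates of [a] are fixed points, and these lie in [S1]
    because [E] takes its values there. *)
Let SA_core : SA `<=` modular_core.
Proof.
move=> a SAa k.
have fa : fixed a.
  by split; [exact: SAS | rewrite -[a]mulr1 E_mod ?E_one //; apply: (sub_one subS)].
have fS1 z : fixed z -> S1 z by move=> [Sz <-]; apply: E1.
split; apply: fS1; elim: k => [|k IH]; rewrite ?expr0 ?mul1r ?mulr1 //.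
  rewrite exprS exprSr !mulrA -[ri * _ * a]mulrA -[ri * _ * _]mulrA.
  by have [_] := fixed_modular IH.
rewrite exprS exprSr !mulrA -[rho * _ * a]mulrA -[rho * _ * _]mulrA.
by have [] := fixed_modular IH.
Qed.

Let coreS : modular_core `<=` S.
Proof. by move=> z /core_sub/S1S. Qed.

Let Thri : Theta ri = ri.
Proof.
by rewrite -[Theta ri]mulr1 -rri mulrA -{1}Thrho -rmorphM rir rmorph1 mul1r.
Qed.

Let core_Theta z : modular_core z -> modular_core (Theta z).
Proof.
move=> Nz k; have [/Th1 + /Th1] := Nz k.
by rewrite !rmorphM !rmorphXn /= Thri Thrho.
Qed.

(* D is the density of phi restricted to the modular core N, and x |-> rho^-1 x rho
   coincides on N with x |-> D^-1 x D, so that D^-1 rho commutes with N. *)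
Lemma modular_factorization : exists D y,
  [/\ pos S D /\ S1 D, pos S y, Theta D = D /\ Theta y = y, rho = D * y
    & forall a, SA a -> a * y = y * a].
Proof.
have subN := core_subalg.
have fdN := finite_dim_sub coreS; have ffN := faithful_positive_sub coreS.
have [D ND Dst] := orthogonal_projection algU linT rho fdS faithS subS subN coreS.
have DE n : modular_core n -> tau (n * rho) = tau (n * D).
  by move=> /(sub_st subN)/Dst; rewrite starK.
have uniqN x y : modular_core x -> modular_core y ->
    (forall n, modular_core n -> tau (n * x) = tau (n * y)) -> x = y.
  move=> Nx Ny xy; apply/eqP; rewrite -subr_eq0; apply/eqP.
  have Nd := subB subN Nx Ny; apply: (faith_eq0 ffN Nd).
  by rewrite mulrBr (tauB linT) xy ?subrr //; apply: (sub_st subN).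
have tau_st x : S x -> tau (star x) = (tau x)^*%C.
  exact: (tau_star algU linT subS faithS).
have sD : star D = D.
  apply: uniqN => // [|n Nn]; first exact: (sub_st subN).
  have Nn' := sub_st subN Nn.
  have -> : n * star D = star (D * star n) by rewrite starM starK.
  rewrite tau_st ?(tauC tauP D); last by apply: (subM subS); apply: coreS.
  rewrite -(DE _ Nn') -tau_st; last by apply: (subM subS) => //; apply: coreS.
  by rewrite starM starK st_rho (tauC tauP rho) DE.
have Dpos s : modular_core s -> tau (star s * D * s) = tau (star s * rho * s).
  move=> Ns; rewrite [LHS](tauC tauP) mulrA -DE; last first.
    by apply: (subM subN) => //; apply: (sub_st subN).
  by rewrite -mulrA [LHS](tauC tauP).
have pD : pos modular_core D.
  split=> // s Ns; rewrite Dpos //; have [_ _] := prho; apply; exact: coreS.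
have Dinj z : modular_core z -> D * z = 0 -> z = 0.
  move=> Nz Dz; have Sz := coreS Nz; apply: inj_rho => //.
  apply: (pos_eq0 algU linT subS fdS faithS prho Sz).
  by rewrite -Dpos // -mulrA Dz mulr0 (tau0 linT).
have [p [pDi DDi DiD]] := pos_inv algU linT subN fdN ffN pD Dinj.
set Di := evr algU D p in pDi DDi DiD.
have [q [pr rr]] := pos_sqrt algU linT subN fdN ffN pDi.
have Dr : GRing.comm D (evr algU Di q) by do 2!apply: evr_comm.
set r := evr algU Di q in pr rr Dr.
have [NDi sDi _] := pDi; have [Nr sr _] := pr.
(* With [n' = rho^-1 n rho] and [m] in the core, [tau (m D n') = tau (n' m D) = tau (n' m rho) = tau
   (m n rho) = tau (m n D)]. *)
have interD n : modular_core n -> D * (ri * n * rho) = n * D.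
  move=> Nn; have [Nm _] := core_modular Nn.
  have E0 : rho * (ri * n * rho) = n * rho by rewrite !mulrA rri mul1r.
  move: (ri * n * rho) E0 Nm => n' E0 Nn'.
  apply: uniqN => [||m Nm]; try exact: (subM subN).
  have -> : tau (m * (D * n')) = tau (n' * m * D).
    by rewrite mulrA (tauC tauP (m * D)) mulrA.
  rewrite -(DE (n' * m)); last exact: (subM subN).
  have -> : tau (n' * m * rho) = tau (m * (rho * n')).
    by rewrite -mulrA (tauC tauP n') mulrA.
  by rewrite E0 !mulrA DE //; apply: (subM subN).
pose y := Di * rho.
(* Apply [interD] to [rho n rho^-1] and multiply by [D^-1] on both sides. *)
have Ny n : modular_core n -> n * y = y * n.
  move=> Nn; have [_ Nm] := core_modular Nn; have := interD _ Nm.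
  rewrite !mulrA -[D * ri * rho]mulrA rir mulr1 -[D * n * ri * rho]mulrA rir mulr1 => H.
  have : Di * (D * n) * Di = Di * (rho * n * ri * D) * Di by rewrite H.
  rewrite !mulrA DiD mul1r -[_ * D * Di]mulrA DDi mulr1 /y => H'.
  by rewrite ?mulrA H' -[_ * ri * rho]mulrA rir mulr1.
have Dy : rho = D * y by rewrite /y mulrA DDi mul1r.
(* As [y] commutes with [r = D^(-1/2)], which lies in the core, it is a conjugate of [rho] and hence
   positive. *)
have yE : y = star r * rho * r.
  rewrite sr [in RHS]Dy mulrA -[_ * y * r]mulrA -Ny // mulrA -Dr.
  by rewrite -(mulrA D) rr DDi mul1r.
have uniq_inv u v : D * u = 1 -> v * D = 1 -> u = v.
  by move=> Du vD; rewrite -[u]mul1r -vD -mulrA Du mulr1.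
(* [Theta D] pairs with the core as [D] does, since the core, [rho] and [tau] are invariant under
   [Theta]. *)
have ThD : Theta D = D.
  apply: uniqN => // [|n Nn]; first exact: core_Theta.
  have NTn := core_Theta Nn; have Sn := coreS Nn; have SD := coreS ND.
  transitivity (tau (Theta n * D)).
    rewrite -{1}(ThK Sn) -rmorphM Thtau //; apply: (subM subS) => //; exact: ThS.
  rewrite -(DE _ NTn) -(DE _ Nn) -{1}Thrho -rmorphM Thtau //; exact: (subM subS).
have ThDi : Theta Di = Di.
  by apply: uniq_inv => //; rewrite -{1}ThD -rmorphM DDi rmorph1.
exists D, y; split=> //.
- split; last exact: core_sub.
  have [p' [[NZ sZ _] <-]] := pos_sqrt algU linT subN fdN ffN pD.
  by rewrite -{1}sZ; apply: (pos_star algU subS) => //; apply: coreS.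
- by rewrite yE; apply: (pos_conj algU subS) => //; apply: coreS.
- by rewrite /y rmorphM /= ThDi Thrho.
- by move=> a /SA_core; apply: Ny.
Qed.
End Factorization.

(** * Densities of faithful states *)

Section Density.
Variables (phi : U -> R[i]) (rho : U).
Hypotheses (phi_state : state_on S phi) (phi_faithful : faithful_on S phi)
  (rhoP : density_on tau S phi rho).

Let phiE x : S x -> phi x = tau (rho * x). Proof. by case: rhoP => _; apply. Qed.
Let Srho : S rho. Proof. by case: rhoP. Qed.

(** Both [phi] and [tau] are hermitian, which makes [rho] self-adjoint; positivity is [tau (star s *
    rho * s) = phi (s * star s)]. *)
Lemma density_pos : pos S rho.
Proof.
case: phi_state => _ phi0 _.
have lin : linear_form iotaU (fun z => tau (rho * z)).
  split=> [x y|k x]; first by rewrite mulrDr (tauD linT).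
  by rewrite /= mulr_algl -scalerAr (tauZ tauP).
have SstM z : S z -> S (star z * z) by move=> Sz; apply/(subM subS)/Sz/(sub_st subS).
have faith : faithful_positive (@star R U) (fun z => tau (rho * z)) S.
  by split=> z Sz; rewrite -(phiE (SstM _ Sz)); [apply: phi0; exists z | apply: phi_faithful].
have st_rho : star rho = rho.
  apply: tau_nondegenerate => // [|z Sz]; first exact: (sub_st subS).
  rewrite -{1}[z]starK -starM (tau_star algU linT subS faithS); last first.
    by apply: (subM subS) => //; apply: (sub_st subS).
  have /= E := tau_star algU lin subS faith Sz.
  by rewrite (tauC tauP (star z)) E conjcK.
split=> // s Ss; rewrite (tauC tauP) mulrA (tauC tauP) -phiE; last first.
  by apply: (subM subS) => //; apply: (sub_st subS).
by apply: phi0; exists (star s); rewrite ?starK //; apply: (sub_st subS).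
Qed.

(** If [rho z = 0] then [phi (z * star z) = 0], and faithfulness applies to [star z]. *)
Lemma density_injective z : S z -> rho * z = 0 -> z = 0.
Proof.
move=> Sz rz; have Sz' := sub_st subS Sz.
rewrite -[z]starK (phi_faithful Sz') ?(st0 algU) // starK phiE.
  by rewrite mulrA rz mul0r (tau0 linT).
exact: (subM subS).
Qed.

Lemma density_even (Theta : {lrmorphism U -> U}) :
    (forall x, S x -> S (Theta x)) -> (forall x, S x -> Theta (Theta x) = x) ->
    (forall x, S x -> tau (Theta x) = tau x) -> even_on Theta S phi ->
  Theta rho = rho.
Proof.
move=> ThS ThK Thtau phi_even; apply: tau_nondegenerate => // [|z Sz]; first exact: ThS.
have STz := ThS _ Sz.
rewrite -{1}(ThK z Sz) -rmorphM Thtau; last exact: (subM subS).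
by rewrite -!phiE // phi_even.
Qed.
End Density.
End StarSubalgebras.

(** * Finite regions and the equivalence *)

Lemma finite_set_uniq_seq (A : set int) : finite_set A ->
  exists2 s : seq int, uniq s & A = [set` s].
Proof.
case/finite_seqP => s ->; exists (undup s); first exact: undup_uniq.
by apply/seteqP; split=> x /=; rewrite mem_undup.
Qed.

Lemma int_fresh (s : seq int) : exists i : int, i \notin s.
Proof.
exists ((\sum_(x <- s) `|x|%N).+1%:Z); apply/negP => H.
have : (`|(\sum_(x <- s) `|x|%N).+1%:Z|%N <= \sum_(x <- s) `|x|%N)%N.
  by rewrite [leqRHS](big_rem _ H) /= leq_addr.
by rewrite absz_nat ltnn.
Qed.

Theorem theorem7 (R : realType) (U : cstarAlgType R) (a : int -> U)
    (CARa : CAR_algebra a)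
    (tau : U -> R[i]) (tau_trace : tracial_state tau)
    (Theta : {lrmorphism U -> U}) (ThetaP : parity_automorphism a Theta)
    (A B C : set int)
    (finA : finite_set A) (finB : finite_set B) (finC : finite_set C)
    (disjAB : A `&` B = set0) (disjAC : A `&` C = set0)
    (disjBC : B `&` C = set0)
    (phi : U -> R[i])
    (phi_state : state_on (local_algebra a (A `|` B `|` C)) phi)
    (phi_faithful : faithful_on (local_algebra a (A `|` B `|` C)) phi)
    (phi_even : even_on Theta (local_algebra a (A `|` B `|` C)) phi)
    (rho : U)
    (rho_density : density_on tau (local_algebra a (A `|` B `|` C)) phi rho) :
  (markov_triplet a A B C phi <->
     exists x y : U,
       [/\ positive_in (local_algebra a (A `|` B)) x,
           positive_in (local_algebra a (B `|` C)) y
         & rho = x * y]) /\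
  (markov_triplet a A B C phi ->
     exists x y : U,
       [/\ positive_in (local_algebra a (A `|` B)) x,
           positive_in (local_algebra a (B `|` C)) y,
           even_element Theta x,
           even_element Theta y
         & rho = x * y]).
Proof.
have [sa ua EA] := finite_set_uniq_seq finA.
have [sb ub EB] := finite_set_uniq_seq finB.
have [sc uc EC] := finite_set_uniq_seq finC.
have dis (s t : seq int) : [set` s] `&` [set` t] = set0 -> ~~ has (mem s) t.
  move=> st; apply/hasPn => x xt; apply/negP => /= xs.
  by have : ([set` s] `&` [set` t]) x by []; rewrite st.
have dab : ~~ has (mem sa) sb by apply: dis; rewrite -EA -EB.
have dac : ~~ has (mem sa) sc by apply: dis; rewrite -EA -EC.
have dbc : ~~ has (mem sb) sc by apply: dis; rewrite -EB -EC.
have uabc : uniq (sa ++ sb ++ sc).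
  by rewrite !cat_uniq ua ub uc dbc has_cat negb_or dab dac.
(* A site outside the three regions carries the extra generator [e]. *)
have [i0 i0N] := int_fresh (sa ++ sb ++ sc).
pose e := (i0, false); pose g := majorana a.
pose KA := majorana_sites sa; pose KB := majorana_sites sb; pose KC := majorana_sites sc.
have gst : forall k, star (g k) = g k by exact: majorana_star.
have gsq := majorana_sq CARa; have gac := majorana_ac CARa.
have eN s : {subset s <= sa ++ sb ++ sc} -> e \notin majorana_sites s.
  by move=> sS; rewrite mem_majorana_sites; apply: contra i0N => /sS.
have local (s : seq int) I : uniq s -> {subset s <= sa ++ sb ++ sc} -> I = [set` s] ->
    local_algebra a I = clifford g (majorana_sites s).
  by move=> us sS IE; apply: (local_algebraE CARa us (eN _ sS) IE).
have setU (s t : seq int) : [set` s] `|` [set` t] = [set` s ++ t].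
  apply/seteqP; split=> x /=; rewrite mem_cat; first by case=> ->; rewrite ?orbT.
  by move/orP.
have EAB : local_algebra a (A `|` B) = clifford g (KA ++ KB).
  rewrite (local (sa ++ sb)) ?majorana_sites_cat //.
  - by rewrite cat_uniq ua ub dab.
  - by move=> x; rewrite !mem_cat => /orP[]->; rewrite ?orbT.
  - by rewrite EA EB setU.
have EBC : local_algebra a (B `|` C) = clifford g (KB ++ KC).
  rewrite (local (sb ++ sc)) ?majorana_sites_cat //.
  - by rewrite cat_uniq ub uc dbc.
  - by move=> x; rewrite !mem_cat => /orP[]->; rewrite ?orbT.
  - by rewrite EB EC setU.
have EABC : local_algebra a (A `|` B `|` C) = clifford g (KA ++ KB ++ KC).
  rewrite (local (sa ++ sb ++ sc)) ?majorana_sites_cat //.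
  by rewrite EA EB EC !setU -catA.
have ELA : local_algebra a A = clifford g KA.
  by rewrite (local sa) // => x; rewrite !mem_cat => ->.
have ELB : local_algebra a B = clifford g KB.
  by rewrite (local sb) // => x; rewrite !mem_cat => ->; rewrite orbT.
have {local} uK : uniq (e :: KA ++ KB ++ KC).
  rewrite -!majorana_sites_cat cons_uniq eN //=; exact: majorana_sites_uniq.
(* [C] comes first because the expectation used below deletes the generators at the head of the
   list. *)
have uKC : uniq (e :: KC ++ KA ++ KB).
  have /perm_uniq -> // : perm_eq (e :: KC ++ KA ++ KB) (e :: KA ++ KB ++ KC).
  by rewrite perm_cons perm_catC -catA.
have uKCB : uniq (e :: KC ++ KB).
  move: uKC; rewrite /= !mem_cat !cat_uniq !negb_or has_cat negb_or.
  by move=> /andP[/and3P[-> _ ->] /and3P[-> /andP[_ ->] /and3P[_ _ ->]]].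
rewrite /markov_triplet EAB EBC EABC ELA ELB in phi_state phi_faithful phi_even rho_density *.
set S := clifford g (KA ++ KB ++ KC) in phi_state phi_faithful phi_even rho_density *.
set S1 := clifford g (KA ++ KB); set S2 := clifford g (KB ++ KC).
set S3 := clifford g KB; set SA := clifford g KA.
have salg s := clifford_subalgebra gst gsq gac s.
have inc s t (st : {subset s <= t}) : clifford g s `<=` clifford g t.
  exact: clifford_sub.
have S1S : S1 `<=` S by apply: inc => x; rewrite !mem_cat orbA => ->.
have S2S : S2 `<=` S by apply: inc => x; rewrite !mem_cat => ->; rewrite orbT.
have S31 : S3 `<=` S1 by apply: inc => x; rewrite !mem_cat => ->; rewrite orbT.
have S32 : S3 `<=` S2 by apply: inc => x; rewrite !mem_cat => ->.
have SA1 : SA `<=` S1 by apply: inc => x; rewrite !mem_cat => ->.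
have SAS : SA `<=` S by move=> z /SA1/S1S.
have [_ Thst Tha] := ThetaP.
have Thg k : Theta (g k) = - g k.
  case: k => i []; rewrite /g /majorana /= ?linearZ /= ?rmorphB ?rmorphD /= Thst Tha starN.
    by rewrite -opprD scalerN.
  by rewrite opprD.
have eS : e \notin KA ++ KB ++ KC by case/andP: uK.
have ThE z : S z -> Theta z = g e * z * g e.
  exact: (parity_gen_conj gsq gac Thg eS).
have Thc s z : clifford g s z -> clifford g s (Theta z).
  elim: s z => [|k s IH] z /=; first by move=> [c _ <-]; exists c; rewrite //= linearZ /= rmorph1.
  move=> [x0 [x1 [/IH H0 /IH H1 ->]]]; exists (Theta x0), (- Theta x1); split=> //.
    exact: cliffordN.
  by rewrite rmorphD rmorphM /= Thg mulrN mulNr.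
have ThK z : S z -> Theta (Theta z) = z.
  move=> Sz; rewrite (ThE _ (Thc _ _ Sz)) (ThE z Sz) !mulrA gsq mul1r -mulrA gsq mulr1 //.
have Thtau z : S z -> tau (Theta z) = tau z.
  by move=> Sz; rewrite ThE // (tauC tau_trace) !mulrA gsq mul1r.
have subS := salg (KA ++ KB ++ KC).
have fdS := clifford_finite_dim g (KA ++ KB ++ KC).
have faithS := clifford_faithful gst gsq gac tau_trace uK.
have prho := density_pos tau_trace subS faithS phi_state phi_faithful rho_density.
have inj_rho := density_injective tau_trace subS phi_faithful rho_density.
have Thrho := density_even tau_trace subS faithS rho_density (Thc _) ThK Thtau phi_even.
have [Srho phiE] := rho_density.
have forward : (exists E : U -> U,
    [/\ completely_positive S S1 E /\ E 1 = 1,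
        forall x y, SA x -> S y -> E (x * y) = x * E y,
        forall x, S x -> phi (E x) = phi x
      & forall x, S2 x -> S3 (E x)]) ->
    exists x y, [/\ positive_in S1 x, positive_in S2 y, even_element Theta x,
      even_element Theta y & rho = x * y].
  move=> [E [[E_cp E1] E_mod E_inv _]].
  have [p [[Sri _ _] rri rir]] := pos_inv (star_algebraU (U := U)) (tau_linear_form tau_trace)
    subS fdS faithS prho inj_rho.
  have E_inv' x : S x -> tau (rho * E x) = tau (rho * x).
    move=> Sx; rewrite -!phiE ?E_inv //.
    by case: E_cp => H _ _; apply/S1S/H.
  have [D [y [[pD S1D] py [ThD Thy] rhoE comm_y]]] := modular_factorization tau_trace
    subS fdS faithS (salg _) S1S SAS (Thc _) (Thc _) ThK Thtau prho inj_rho Thrho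
    E_cp E1 E_mod E_inv' Sri rir rri.
  have [Sy _ _] := py.
  exists D, y; split=> //; first exact: (pos_positive_in tau_trace subS fdS faithS (salg _)).
  apply: (pos_positive_in tau_trace subS fdS faithS (salg _)) => //.
  (* [y] is even and commutes with the generators of [A], so only those of [B] and [C] remain. *)
  apply: (commutant_clifford gsq gac uK Sy); first by rewrite -ThE.
  by move=> k kA; apply: comm_y; apply: clifford_gen.
split; last exact: forward.
split; first by move/forward => [x [y [? ? _ _ ?]]]; exists x, y.
move=> [x0 [y0 [px0 py0 rho0]]].
have in1 x : positive_in S1 x -> S1 x.
  by move=> [z Sz ->]; apply: (subM (salg _)) => //; apply: (sub_st (salg _)).
have in2 x : positive_in S2 x -> S2 x.
  by move=> [z Sz ->]; apply: (subM (salg _)) => //; apply: (sub_st (salg _)).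
have pos1 x : positive_in S1 x -> pos_elt (@star R U) tau S x.
  exact: (positive_in_pos subS faithS S1S).
have pos2 x : positive_in S2 x -> pos_elt (@star R U) tau S x.
  exact: (positive_in_pos subS faithS S2S).
(* Since [rho] is self-adjoint, [x y = star (x y) = y x]. *)
have comm x y : positive_in S1 x -> positive_in S2 y -> rho = x * y -> x * y = y * x.
  move=> /pos1[_ sx _] /pos2[_ sy _] E; have [_ srho _] := prho.
  by rewrite -{1}E -srho E starM sx sy.
have ev0 : Theta (x0 * y0) = x0 * y0 by rewrite -rho0.
have inj0 z : S z -> x0 * y0 * z = 0 -> z = 0 by rewrite -rho0; apply: inj_rho.
(* The factors are made even first, because evenness is what makes [y] commute with the algebra of
   [A]. *)
have [x [y [px py Thx Thy xyE]]] := even_factorization tau_trace subS fdS faithS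
  (Theta := Theta) (salg _) (salg _) Thst (Thc _) (Thc _) (Thc _) ThK
  (pos1 _ px0) (pos2 _ py0) (in1 _ px0) (in2 _ py0) (comm _ _ px0 py0 rho0)
  ev0 inj0.
rewrite -rho0 in xyE; have Sy := S2S _ (in2 _ py).
(* Deleting the generators of [C] maps [S] into [S1] and [S2] into [S3]. *)
pose F := cond_exp g e KC.
have SKC : S `<=` clifford g (KC ++ KA ++ KB).
  by apply: inc => z; rewrite !mem_cat orbA orbC.
have S2KC : S2 `<=` clifford g (KC ++ KB).
  by apply: inc => z; rewrite !mem_cat orbC.
have inj1 z : S z -> x * y * z = 0 -> z = 0 by rewrite -xyE; apply: inj_rho.
have SAy z : SA z -> GRing.comm z y.
  move=> SAz; apply: (even_comm gsq gac (e := e) _ _ SAz (in2 _ py)).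
  - move=> k kA; apply: contraL kA; move: uK; rewrite cons_uniq cat_uniq.
    by case/and4P => _ _ /hasPn H _ /H.
  - by move: eS; rewrite mem_cat negb_or => /andP[].
  - by rewrite -ThE.
have [E [E_cp E_mod E_inv E_loc]] := expectation_exists tau_trace subS fdS faithS
    (S1 := S1) (S2 := S2) (S3 := S3) (SA := SA) (F := F)
    (salg _) (salg _) (salg _) S1S S2S S31 S32 SA1
    (cond_exp_lin g e KC) (cond_exp_star gst e KC)
    (fun z Sz => clifford_cond_exp gsq gac uKC (SKC z Sz))
    (fun z Sz => clifford_cond_exp gsq gac uKCB (S2KC z Sz))
    (fun z u S1z => cond_exp_modl gsq gac u uKC S1z)
    (fun z u S1z => cond_exp_modr gst gsq gac u uKC S1z)
    (fun z => tau_cond_exp gsq e KC z tau_trace)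
    (pos1 _ px) (pos2 _ py) (in1 _ px) (in2 _ py) (comm _ _ px py xyE)
    inj1 SAy.
exists E; split=> // z Sz; rewrite !phiE //; first by rewrite xyE E_inv.
by case: E_cp => [[H _ _] _]; apply/S1S/H.
Qed.
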